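(* Let $n\ge 3$ be odd. Let $(y^\mu)=(\tau,\vec y)\in\mathbb{R}\times\mathbb{R}^n$, $\rho=|\vec y|$, and let $g$ be a Lorentzian metric defined on $\{|\tau|<\rho<\delta\}$ for some $\delta>0$, of the form $$g=\frac{1}{(\rho^2-\tau^2)^2}\,\tilde g,\qquad \tilde g_{\mu\nu}=\eta_{\mu\nu}+\tilde h_{\mu\nu},$$ where $\eta=-d\tau^2+\sum_{i=1}^n(dy^i)^2$, and where the functions $\tilde h_{\mu\nu}$ are of differentiability class $C^{n-2}$ in a neighborhood of the origin $\{\tau=0,\vec y=0\}$ and satisfy $\tilde h_{\mu\nu}=O(\rho^{n-2})$ as $\rho\to 0$ in $\{|\tau|\le\rho\}$. Let $\gamma=g_{ij}\,dx^i dx^j$ be the Riemannian metric induced by $g$ on $\{\tau=0\}$ near $\rho=0$, expressed in the coordinates $x^i=y^i/\rho^2$, so that $\gamma$ is defined for $|x|$ large. Then the ADM mass of $\gamma$ vanishes. In particular, in even spacetime dimensions $n+1$, no conformal completion of this form with $\tilde h_{\mu\nu}$ of class $C^{n-2}$ exists if the ADM mass is non-zero.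
   Context: The ADM mass of $\gamma=g_{ij}dx^idx^j$ in the coordinates $x^i$ is, up to a fixed non-zero multiplicative constant depending only on $n$, $$\lim_{R\to\infty}\int_{|x|=R}\sum_{i,j=1}^n\left(\frac{\partial g_{ij}}{\partial x^j}-\frac{\partial g_{jj}}{\partial x^i}\right)\frac{x^i}{|x|}\,dS,$$ where $dS$ is the Euclidean area element of the sphere $|x|=R$ in $\mathbb{R}^n$. ''Vanishes'' means that the limit exists and equals $0$. *)

(* Defs.v *)
From mathcomp Require Import all_boot all_order all_algebra.
From mathcomp Require Import all_classical all_reals all_analysis.

Set Implicit Arguments.
Unset Strict Implicit.
Unset Printing Implicit Defensive.

Import Order.TTheory GRing.Theory Num.Theory.
Import numFieldNormedType.Exports.

Local Open Scope classical_set_scope.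
Local Open Scope ring_scope.

(* The norm of the library on row vectors is the sup norm (same topology). *)
Definition enorm (R : realType) (m : nat) (x : 'rV[R]_m) : R :=
  Num.sqrt (\sum_(i < m) x 0 i ^+ 2).

Definition partial (R : realType) (m : nat) (i : 'I_m) (f : 'rV[R]_m -> R)
    : 'rV[R]_m -> R :=
  'D_(delta_mx 0 i) f.

(* f is of class C^k on U: its iterated partial derivatives of order at most k
   exist and are continuous at every point of U. Meant for open U. *)
Fixpoint Ck (R : realType) (m k : nat) (U : set 'rV[R]_m) (f : 'rV[R]_m -> R)
    : Prop :=
  (forall x, U x -> {for x, continuous f}) /\
  if k is k'.+1 then
    forall i : 'I_m,
      (forall x, U x -> derivable f x (delta_mx 0 i)) /\ Ck k' U (partial i f)
  else True.

(* A metric is represented by the matrix of its components. For row vectors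
   ('J phi x) i k is the derivative of the k-th component of phi along the
   i-th coordinate. *)
Definition pullback (R : realType) (m p : nat) (phi : 'rV[R]_m -> 'rV[R]_p)
    (G : 'rV[R]_p -> 'M[R]_p) (x : 'rV[R]_m) : 'M[R]_m :=
  'J phi x *m G (phi x) *m ('J phi x)^T.

(* Points of spacetime are y = (tau, y_1, .., y_n) in 'rV_(1 + n), with the
   time coordinate at index 0. *)
Definition tau (R : realType) (n : nat) (y : 'rV[R]_(1 + n)) : R := y 0 0.

Definition rho (R : realType) (n : nat) (y : 'rV[R]_(1 + n)) : R :=
  enorm (rsubmx y).

Definition eta (R : realType) (n : nat) : 'M[R]_(1 + n) :=
  block_mx (- 1%:M) 0 0 1%:M.

(* Signature (-, +, .., +): existence of an orthonormal frame (rows of P). *)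
Definition lorentzian (R : realType) (n : nat) (G : 'M[R]_(1 + n)) : Prop :=
  G^T = G /\ exists2 P : 'M[R]_(1 + n), P \in unitmx & P *m G *m P^T = eta R n.

(* The components h are total functions; their values are constrained only on
   a neighborhood of the origin and on |tau| < rho < delta. In the Landau
   condition, y --> 0 within |tau| <= rho amounts to rho --> 0 there. *)
Record conformal_completion (R : realType) (n : nat) (delta : R)
    (g h : 'rV[R]_(1 + n) -> 'M[R]_(1 + n)) : Prop := {
  completion_delta_gt0 : 0 < delta;
  completion_lorentzian : forall y,
    `|tau y| < rho y < delta -> lorentzian (g y);
  completion_conformal : forall y,
    `|tau y| < rho y < delta ->
    g y = (rho y ^+ 2 - tau y ^+ 2) ^- 2 *: (eta R n + h y);
  completion_class :
    exists2 U : set 'rV[R]_(1 + n), open_nbhs (0 : 'rV[R]_(1 + n)) U &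
      forall mu nu, Ck (n - 2) U (fun y => h y mu nu);
  completion_decay :
    let F := within [set y | `|tau y| <= rho y] (nbhs (0 : 'rV[R]_(1 + n))) in
    forall mu nu, (fun y => h y mu nu) =O_F (fun y => rho y ^+ (n - 2))
}.

(* The map x |-> y inverse to x = y / |y|^2 (it is an involution). *)
Definition inversion (R : realType) (n : nat) (x : 'rV[R]_n) : 'rV[R]_n :=
  enorm x ^- 2 *: x.

Definition time_zero (R : realType) (n : nat) (y : 'rV[R]_n)
    : 'rV[R]_(1 + n) :=
  row_mx 0 y.

Definition slice_metric (R : realType) (n : nat)
    (g : 'rV[R]_(1 + n) -> 'M[R]_(1 + n)) : 'rV[R]_n -> 'M[R]_n :=
  pullback (@inversion R n) (pullback (@time_zero R n) g).

(* Integral over the Euclidean unit sphere of R^m in spherical coordinates: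
   writing a point as (cos t, sin t * w) with 0 <= t <= pi and w on the unit
   sphere one dimension lower, the area element on the unit sphere of R^(k+2)
   is (sin t)^k dt times that of the unit sphere of R^(k+1). The sphere of R^1
   is {1, -1} with the counting measure. *)
Fixpoint unit_sphere_integral (R : realType) (m : nat)
    : ('rV[R]_m -> R) -> R :=
  match m with
  | 0 => fun _ => 0
  | m'.+1 =>
    match m' return (('rV[R]_m' -> R) -> R) -> ('rV[R]_m'.+1 -> R) -> R with
    | 0 => fun _ f => f (const_mx 1) + f (const_mx (-1))
    | k.+1 => fun lower f =>
        \int[lebesgue_measure]_(t in `[0, pi])
          (sin t ^+ k *
           lower (fun w => f (row_mx (cos t)%:M (sin t *: w) : 'rV[R]_(1 + k.+1))))
    end (@unit_sphere_integral R m')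
  end.

Definition sphere_integral (R : realType) (n : nat) (r : R)
    (f : 'rV[R]_n -> R) : R :=
  r ^+ n.-1 * unit_sphere_integral (fun w => f (r *: w)).

Definition adm_flux (R : realType) (n : nat) (gamma : 'rV[R]_n -> 'M[R]_n)
    (r : R) : R :=
  sphere_integral r (fun x =>
    \sum_(i < n) \sum_(j < n)
      (partial j (fun z => gamma z i j) x - partial i (fun z => gamma z j j) x)
      * (x 0 i / enorm x)).

Definition adm_mass_vanishes (R : realType) (n : nat)
    (gamma : 'rV[R]_n -> 'M[R]_n) : Prop :=
  adm_flux gamma r @[r --> +oo] --> (0 : R).

(* Main.v *)
From HB Require Import structures.
Require Import Defs.
From mathcomp Require Import all_boot all_order all_algebra.
From mathcomp Require Import all_classical all_reals all_analysis.
From mathcomp Require Import ring.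

Import Order.TTheory GRing.Theory Num.Theory.
Import numFieldNormedType.Exports.

Local Open Scope classical_set_scope.
Local Open Scope ring_scope.

Set Implicit Arguments.
Unset Strict Implicit.
Unset Printing Implicit Defensive.

(* In the coordinates x = y / |y|^2 the induced metric is
     gamma(x) = 1 + A(x) u(y) A(x),    A(x) = 1 - 2 x x^T / |x|^2,
   where u is the spatial part of h at tau = 0; it is of class C^(n-2) and
   O(|y|^(n-2)). Were u a homogeneous polynomial of odd degree n - 2, the flux
   density of gamma would be odd, and its integral over a sphere would vanish.
   In general u(y) + u(-y) = o(|y|^(n-2)), and likewise
   du(y) - du(-y) = o(|y|^(n-3)), so the flux densities at x and -x add up to
   o(|x|^(1-n)); as the sphere integral is invariant under the antipodal map,
   the flux tends to 0. *)

(** * Integration over the unit sphere *)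

(** No Taylor polynomial is ever built. A homogeneous polynomial of degree [m] is killed by
    [f y - (-1)^m f (- y)], and a partial derivative of this combination is the same combination in
    degree [m - 1] for a partial derivative of [f]; after [m] steps only continuity at 0 is left.
    The descent needs the decay [O(|y|^m)] to pass to partial derivatives as [O(|y|^(m-1))], which
    decay alone does not give. It comes from interpolation between the decay of [f] and the local
    boundedness of its derivatives of order [m]. In [gamma] the powers balance exactly: with
    [L = 1 / |x|], differentiating [A] contributes a factor [L], while differentiating [u] through
    the inversion loses one power of [L] and gains [L ^ 2] from the Jacobian. Both terms have size
    [L ^ (n-1)] against an area of order [L ^ (1-n)], so size estimates alone only bound the flux,
    and the gain from [O] to [o] must come from parity. *)

Lemma cvg_sumr (R : realType) (T I : Type) (F : set_system T) {FF : Filter F}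
    (r : seq I) (phi : I -> T -> R) (l : I -> R) :
  (forall i, phi i x @[x --> F] --> l i) ->
  \sum_(i <- r) phi i x @[x --> F] --> \sum_(i <- r) l i.
Proof. by move=> phil; apply: cvg_big => //; exact: add_continuous. Qed.

Lemma cvg_rV (R : realType) (T : Type) (F : set_system T) {FF : Filter F} (m : nat)
    (phi : T -> 'rV[R]_m) (l : 'rV[R]_m) :
  (forall i, phi x 0 i @[x --> F] --> l 0 i) -> phi x @[x --> F] --> l.
Proof.
move=> phil; apply/cvgrPdist_lt => e e0; near=> x.
rewrite [X in X < _]/Num.Def.normr/= mx_normrE.
rewrite bigmax_lt => //= -[i j] _ /=; rewrite !mxE (ord1 i).
move: j; near: x; apply: filter_forall => j.
by move/cvgrPdist_lt : (phil j) => /(_ _ e0).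
Unshelve. all: by end_near. Qed.

Definition unit_sphere (R : realType) (m : nat) : set 'rV[R]_m :=
  [set x | \sum_(i < m) x 0 i ^+ 2 = 1].

Lemma coord_le_norm (R : realType) (m : nat) (x : 'rV[R]_m) i : `|x 0 i| <= `|x|.
Proof.
rewrite [leRHS]/Num.Def.normr/= mx_normrE.
exact: (le_bigmax _ (fun ij : 'I_1 * 'I_m => `|x ij.1 ij.2|) (0, i)).
Qed.

Lemma norm_rV_le (R : realType) (m : nat) (x : 'rV[R]_m) (e : R) :
  0 <= e -> (forall i, `|x 0 i| <= e) -> `|x| <= e.
Proof.
move=> e0 xe; rewrite [leLHS]/Num.Def.normr/= mx_normrE.
by apply: bigmax_le => // -[i j] _ /=; rewrite (ord1 i).
Qed.

Lemma continuous_sum_sqr (R : realType) (m : nat) :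
  continuous (fun x : 'rV[R]_m => \sum_(i < m) x 0 i ^+ 2).
Proof.
move=> x; apply: (@cvg_sumr _ _ _ _ (nbhs_filter x)) => i.
by apply: (@continuous_comp _ _ _ (fun y : 'rV[R]_m => y 0 i) (fun z => z ^+ 2));
  [exact: coord_continuous|exact: exprn_continuous].
Qed.

Lemma compact_unit_sphere (R : realType) (m : nat) : compact (@unit_sphere R m).
Proof.
apply: bounded_closed_compact.
  exists 1; split => // M M1 x Sx /=; apply: norm_rV_le => [|i].
    exact/ltW/(lt_trans _ M1).
  apply: le_trans (ltW M1); rewrite -(@ler_pXn2r _ 2)// ?nnegrE//.
  rewrite expr1n -Sx (bigD1 i)//= real_normK ?num_real// lerDl.
  by apply: sumr_ge0 => j _; exact: sqr_ge0.
have -> : @unit_sphere R m =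
  (fun x : 'rV[R]_m => \sum_(i < m) x 0 i ^+ 2) @^-1` [set 1] by [].
apply: closed_comp => [x _|]; [exact: continuous_sum_sqr|exact: closed_eq].
Qed.

Definition polar (R : realType) (k : nat) (t : R) (w : 'rV[R]_k.+1) :
  'rV[R]_(1 + k.+1) := row_mx (cos t)%:M (sin t *: w).

Lemma polar_unit_sphere (R : realType) (k : nat) (t : R) (w : 'rV[R]_k.+1) :
  unit_sphere w -> unit_sphere (polar t w).
Proof.
move=> Sw; rewrite /unit_sphere /polar /= big_split_ord/= big_ord1.
rewrite row_mxEl mxE eqxx mulr1n.
under eq_bigr do rewrite row_mxEr mxE exprMn.
by rewrite -mulr_sumr Sw mulr1 cos2Dsin2.
Qed.

Lemma polar_continuous (R : realType) (k : nat) :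
  continuous (fun z : R * 'rV[R]_k.+1 => polar z.1 z.2).
Proof.
move=> z; apply: (@cvg_rV _ _ _ (nbhs_filter z)) => i; rewrite /polar.
case: (split_ordP i) => j ->.
  rewrite row_mxEl mxE (ord1 j) eqxx mulr1n.
  under eq_fun do rewrite row_mxEl mxE mulr1n.
  by apply: (@continuous_comp _ _ _ fst cos); [exact: cvg_fst|exact: continuous_cos].
rewrite row_mxEr mxE; under eq_fun do rewrite row_mxEr mxE.
apply: cvgM.
  by apply: (@continuous_comp _ _ _ fst sin); [exact: cvg_fst|exact: continuous_sin].
apply: (@continuous_comp _ _ _ snd (fun y : 'rV[R]_k.+1 => y 0 j)).
  exact: cvg_snd.
exact: coord_continuous.
Qed.

(** Continuity in the ambient space at the points of the sphere, which asks more than continuity of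
    the restriction. It passes to the slices [f (polar t w)] by composition, and the rescaled flux
    density has it for large radii. *)
Definition continuous_on_sphere (R : realType) (m : nat) (f : 'rV[R]_m -> R) :=
  forall x, unit_sphere x -> {for x, continuous f}.

Section polar_slices.
Variables (R : realType) (k : nat) (f : 'rV[R]_k.+2 -> R).
Hypothesis cf : continuous_on_sphere f.

Lemma continuous_polar_slice (t : R) :
  continuous_on_sphere (fun w : 'rV[R]_k.+1 => f (polar t w)).
Proof.
move=> w Sw; apply: (@continuous_comp _ _ _ (polar t) f); last first.
  exact/cf/polar_unit_sphere.
apply: (@continuous_comp _ _ _ (fun w => (t, w)) (fun z => polar z.1 z.2)).
  exact: (@cvg_pair _ _ _ (nbhs w) (nbhs t) (nbhs w) (nbhs_filter w) _ _
    (fun=> t) id (cvg_cst t) cvg_id).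
exact: polar_continuous.
Qed.

(** Compactness of the sphere turns continuity of [f (polar t w)] in the pair [(t, w)] into a bound
    uniform in [w]; this is what makes the inner integral continuous in [t]. *)
Lemma near_polar_slice (t0 e : R) : 0 < e ->
  \forall t \near t0, forall w : 'rV[R]_k.+1, unit_sphere w ->
    `|f (polar t w) - f (polar t0 w)| <= e.
Proof.
move=> e0.
have := @compact_unit_sphere R k.+1 => /compact_near_coveringP.
move=> /(_ _ (nbhs t0)
  (fun t w => `|f (polar t w) - f (polar t0 w)| <= e)) /=.
apply => w Sw.
have e20 : 0 < e / 2 by rewrite divr_gt0.
have cfw := cf (polar_unit_sphere t0 Sw).
have : \forall z \near (t0, w), `|f (polar t0 w) - f (polar z.1 z.2)| < e / 2.
  have : {for (t0, w), continuous
      (fun z : R * 'rV[R]_k.+1 => f (polar z.1 z.2))}.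
    apply: (@continuous_comp _ _ _
      (fun z : R * 'rV[R]_k.+1 => polar z.1 z.2) f).
      exact: polar_continuous.
    exact: cfw.
  by move/cvgrPdist_lt => /(_ _ e20).
move=> H; have [[A B] /= [At0 Bw] AB] := H.
exists (B, A) => //= -[y t] /= [By At].
(* Both [(t, y)] and [(t0, y)] lie in the neighbourhood of [(t0, w)], so each value is within
   [e / 2] of [f (polar t0 w)]. *)
have /= H1 := AB (t, y) (conj At By).
have /= H2 := AB (t0, y) (conj (nbhs_singleton At0) By).
rewrite (splitr e) -[X in `|X|](subrKA (f (polar t0 w))).
by rewrite (le_trans (ler_normD _ _))// lerD// ltW// distrC.
Qed.

End polar_slices.

(** Reduces antipodal invariance of the integral to a reflection of the interval of [t] and
    antipodal invariance one dimension lower. *)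
Lemma polar_antipode (R : realType) (k : nat) (t : R) (w : 'rV[R]_k.+1) :
  polar (pi - t) (- w) = - polar t w.
Proof.
rewrite /polar opp_row_mx sinB cosB sinpi cospi !mul0r !mulN1r addr0 opprK.
by rewrite add0r scalerN raddfN.
Qed.

Lemma unit_sphere_integralS (R : realType) (k : nat) (f : 'rV[R]_k.+2 -> R) :
  unit_sphere_integral f =
  \int[lebesgue_measure]_(t in `[0, pi])
    (sin t ^+ k * unit_sphere_integral (fun w => f (polar t w))).
Proof. by []. Qed.

Lemma integrable_continuous_segment (R : realType) (a b : R) (f : R -> R) :
  continuous f -> lebesgue_measure.-integrable `[a, b] (EFin \o f).
Proof.
move=> cf; apply: continuous_compact_integrable; first exact: segment_compact.
exact: continuous_subspaceT.
Qed.

Lemma Rintegral_segment_le (R : realType) (a b e : R) (f : R -> R) : a <= b ->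
  continuous f -> (forall t, `|f t| <= e) ->
  `|\int[lebesgue_measure]_(t in `[a, b]) f t| <= e * (b - a).
Proof.
move=> ab cf fe.
apply: (le_trans (le_normr_Rintegral _ (integrable_continuous_segment a b cf))) => //.
have -> : e * (b - a) = \int[lebesgue_measure]_(t in `[a, b]) e.
  rewrite Rintegral_cst//= lebesgue_measure_itv/= lte_fin.
  by case: (ltgtP a b) ab => //= -> _; rewrite subrr.
apply: le_Rintegral => //; apply: integrable_continuous_segment.
  by move=> x; apply: continuous_comp; [exact: cf|exact: norm_continuous].
by move=> x; exact: cvg_cst.
Qed.

Lemma Rintegral_reflect (R : realType) (a : R) (f : R -> R) : 0 <= a ->
  continuous f -> \int[lebesgue_measure]_(t in `[0, a]) f (a - t) =
                  \int[lebesgue_measure]_(t in `[0, a]) f t.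
Proof.
move=> a0 cf.
have dF (x : R) : is_derive x (1 : R) (fun t : R => a - t) (-1).
  have := is_deriveB (is_derive_cst a x (1 : R)) (is_derive_id x (1 : R)).
  by rewrite sub0r.
have dF1 : (fun t : R => a - t)^`()%classic = cst (-1).
  by apply/funext => x; rewrite derive1E; exact: derive_val.
have cF : continuous (fun t : R => a - t).
  by move=> x; apply: cvgB; [exact: cvg_cst|exact: cvg_id].
have := @integration_by_substitution_decreasing R (fun t => a - t) f 0 a a0.
rewrite /Rintegral subr0 subrr => ->.
- congr fine; apply: eq_integral => x _ /=.
  by rewrite dF1 /= opprK mulr1.
- by move=> x y _ _ xy; rewrite ltrD2l ltrN2.
- by rewrite dF1; move=> ? ?; exact: cvg_cst.
- by rewrite dF1; exact: is_cvg_cst.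
- by rewrite dF1; exact: is_cvg_cst.
- split => [x _||].
  + exact: ex_derive.
  + exact/cvg_at_right_filter/cF.
  + exact/cvg_at_left_filter/cF.
- exact: continuous_subspaceT.
Qed.

(** All that the flux argument uses of the sphere integral: a sup norm bound, linearity and
    antipodal invariance. They go through the induction on the dimension together, since continuity
    of the outer integrand rests on the bound and on linearity one dimension below. *)
Definition sphere_functional_spec (R : realType) (m : nat) (C : R) :=
  [/\ forall (f : 'rV[R]_m -> R) e, continuous_on_sphere f ->
        (forall x, unit_sphere x -> `|f x| <= e) ->
        `|unit_sphere_integral f| <= C * e,
      forall c (f g : 'rV[R]_m -> R),
        continuous_on_sphere f -> continuous_on_sphere g ->
        unit_sphere_integral (fun x => c * f x + g x) =
        c * unit_sphere_integral f + unit_sphere_integral g &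
      forall f : 'rV[R]_m -> R, continuous_on_sphere f ->
        unit_sphere_integral (fun x => f (- x)) = unit_sphere_integral f].

Section polar_step.
Variables (R : realType) (k : nat) (C : R).
Hypotheses (C0 : 0 <= C) (HC : @sphere_functional_spec R k.+1 C).

Let integrand (f : 'rV[R]_k.+2 -> R) (t : R) :=
  sin t ^+ k * unit_sphere_integral (fun w => f (polar t w)).

Let continuous_integrand f : continuous_on_sphere f -> continuous (integrand f).
Proof.
move=> cf t0; apply: cvgM.
  apply: (@continuous_comp _ _ _ sin (fun z : R => z ^+ k)).
    exact: continuous_sin.
  exact: (@exprn_continuous R k).
have [bnd lin _] := HC.
apply/cvgrPdist_le => e e0.
(* [C] may be 0, hence the division by [C + 1]. *)
have e1 : 0 < e / (C + 1) by rewrite divr_gt0// ltr_wpDl.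
near=> t.
have : forall w : 'rV[R]_k.+1, unit_sphere w ->
    `|f (polar t w) - f (polar t0 w)| <= e / (C + 1).
  by near: t; exact: (near_polar_slice cf t0 e1).
move=> H; rewrite distrC.
have cs s := @continuous_polar_slice R k f cf s.
have -> : unit_sphere_integral (fun w => f (polar t w)) -
    unit_sphere_integral (fun w => f (polar t0 w)) =
    unit_sphere_integral (fun w => -1 * f (polar t0 w) + f (polar t w)).
  by rewrite lin// mulN1r addrC.
apply: (@le_trans _ _ (C * (e / (C + 1)))).
  apply: bnd => [|w Sw]; last by rewrite mulN1r addrC; exact: H.
  by move=> w Sw; apply: (@continuousD _ _ _ (fun w => -1 * f (polar t0 w)));
    [apply: (@continuousM _ _ (fun=> -1)); [exact: cst_continuous|exact: cs]
    |exact: cs].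
rewrite mulrCA ger_pMr// ler_pdivrMr ?mul1r ?lerDl//.
by rewrite ltr_wpDl.
Unshelve. all: by end_near. Qed.

Let norm_integrand_le f e t : continuous_on_sphere f ->
  (forall x, unit_sphere x -> `|f x| <= e) -> `|integrand f t| <= C * e.
Proof.
move=> cf fe; have [bnd _ _] := HC.
rewrite normrM normrX -[leRHS]mul1r ler_pM//.
  by apply: exprn_ile1 => //; rewrite ler_norml sin_geN1 sin_le1.
apply: bnd => [|w Sw]; first exact: continuous_polar_slice.
exact/fe/polar_unit_sphere.
Qed.

(** The factor [pi] is the length of the range of [t], as [|sin t ^+ k| <= 1]. Since
    [sin (pi - t) = sin t], the weight survives the reflection of [t]. *)
Lemma sphere_functional_step : @sphere_functional_spec R k.+2 (C * pi).
Proof.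
have [bnd lin neg] := HC.
have pi0 : 0 <= pi :> R by exact: pi_ge0.
split.
- move=> f e cf fe; rewrite unit_sphere_integralS.
  have -> : C * pi * e = C * e * (pi - 0) by rewrite subr0 mulrAC.
  apply: Rintegral_segment_le => //; first exact: continuous_integrand.
  by move=> t; exact: norm_integrand_le.
- move=> c f g cf cg; rewrite !unit_sphere_integralS.
  have If := integrable_continuous_segment 0 pi (continuous_integrand cf).
  have Ig := integrable_continuous_segment 0 pi (continuous_integrand cg).
  have E t : integrand (fun x => c * f x + g x) t =
      c * integrand f t + integrand g t.
    rewrite /integrand lin; [|exact: continuous_polar_slice..].
    by rewrite mulrDr mulrCA.
  rewrite -RintegralZl// -RintegralD//; last first.
    rewrite (_ : _ \o _ = (fun t => c%:E * (EFin \o integrand f) t)%E)//.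
    exact: integrableZl.
  by apply: eq_Rintegral => t _; exact: E.
- move=> f cf; rewrite !unit_sphere_integralS.
  rewrite -(Rintegral_reflect pi0 (continuous_integrand cf)).
  apply: eq_Rintegral => t _; rewrite /integrand.
  rewrite sinB sinpi cospi mul0r mulN1r opprK add0r; congr (_ * _).
  rewrite -(neg _ (@continuous_polar_slice _ _ _ cf (pi - t))).
  congr unit_sphere_integral; apply/funext => w; congr f.
  exact/esym/polar_antipode.
Qed.

End polar_step.

Lemma sphere_functional (R : realType) (m : nat) :
  exists2 C, 0 <= C & @sphere_functional_spec R m C.
Proof.
elim: m => [|[|k] IH].
- exists 0 => //; split=> [f e _ _|c f g _ _|//] /=.
    by rewrite normr0 mul0r.
  by rewrite mulr0 addr0.
(* Dimension 1: two points of mass 1, exchanged by the antipodal map. *)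
- exists 2 => //; split=> [f e _ fe|c f g _ _|f _] /=.
  + rewrite (le_trans (ler_normD _ _))// mulr_natl mulr2n lerD// fe//.
      by rewrite /unit_sphere/= big_ord1 mxE expr1n.
    by rewrite /unit_sphere/= big_ord1 mxE sqrrN expr1n.
  + by rewrite mulrDr addrACA.
  + rewrite addrC; congr (f _ + f _); apply/matrixP => i j.
      by rewrite !mxE opprK.
    by rewrite !mxE.
- have [C C0 HC] := IH.
  by exists (C * pi); [rewrite mulr_ge0// pi_ge0|exact: sphere_functional_step].
Qed.

(** * Functions with continuous partial derivatives *)

(** The one-variable difference quotient along the line is literally the directional one, so
    derivability in a single direction already permits mean value arguments. *)
Lemma is_derive_line (R : realType) (m : nat) (f : 'rV[R]_m -> R)
    (x v : 'rV[R]_m) (s : R) : derivable f (s *: v + x) v ->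
  is_derive s 1 (fun t : R => f (t *: v + x)) ('D_v f (s *: v + x)).
Proof.
have E : (fun h : R => h^-1 *: (f ((h *: 1 + s) *: v + x) - f (s *: v + x))) =
    (fun h : R => h^-1 *: (f (h *: v + (s *: v + x)) - f (s *: v + x))).
  by apply/funext => h; rewrite [h *: 1]mulr1 scalerDl addrA.
by move=> df; apply: DeriveDef; rewrite /derivable /derive E.
Qed.

Lemma mean_value_le (R : realType) (g dg : R -> R) (b c e : R) :
  (forall s : R, `|s| <= `|b| -> is_derive s 1 g (dg s)) ->
  (forall s, `|s| <= `|b| -> `|dg s - c| <= e) ->
  `|g b - g 0 - c * b| <= e * `|b|.
Proof.
move=> dgP dgc.
have cont (u v : R) : (forall s, s \in `[u, v] -> `|s| <= `|b|) ->
    {within `[u, v], continuous g}.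
  move=> uv; apply: derivable_within_continuous => s /uv sb.
  by have [] := dgP _ sb.
have [b0|b0] := leP 0 b.
  have sub s : s \in `[0, b] -> `|s| <= `|b|.
    by rewrite in_itv/= => /andP[s0 sb]; rewrite !ger0_norm.
  have [s sb ->] := MVT_segment b0 (fun s h => dgP s (sub s (subset_itv_oo_cc h)))
    (cont _ _ sub).
  by rewrite subr0 -mulrBl normrM ler_wpM2r// dgc// sub.
have sub s : s \in `[b, 0] -> `|s| <= `|b|.
  by rewrite in_itv/= => /andP[sb s0]; rewrite !ler0_norm ?lerN2// ltW.
have [s sb] := MVT_segment (ltW b0)
  (fun s h => dgP s (sub s (subset_itv_oo_cc h))) (cont _ _ sub).
rewrite sub0r mulrN => /eqP; rewrite -eqr_oppLR opprB => /eqP ->.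
by rewrite -mulrBl normrM ler_wpM2r// dgc// sub.
Qed.

Lemma norm_delta_le (R : realType) (m : nat) (i : 'I_m) :
  `|delta_mx 0 i : 'rV[R]_m| <= 1.
Proof.
apply: norm_rV_le => // j; rewrite mxE.
by case: (_ && _); rewrite ?normr1 ?normr0.
Qed.

(* Moves from x to x + v one coordinate at a time, so that only partial
   derivatives are involved. *)
Lemma increment_le (R : realType) (m : nat) (f : 'rV[R]_m -> R)
    (x v : 'rV[R]_m) (c : 'I_m -> R) (e : R) :
  (forall z i, `|z - x| <= `|v| -> derivable f z (delta_mx 0 i)) ->
  (forall z i, `|z - x| <= `|v| -> `|partial i f z - c i| <= e) ->
  `|f (x + v) - f x - \sum_(i < m) c i * v 0 i| <= m%:R * e * `|v|.
Proof.
move=> df dfc.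
pose w p : 'rV[R]_m := \row_i (if (i < p)%N then v 0 i else 0).
have w0 : w 0%N = 0 by apply/rowP => i; rewrite !mxE.
have wm : w m = v by apply/rowP => i; rewrite !mxE ltn_ord.
suff H p : (p <= m)%N -> `|f (x + w p) - f x -
    \sum_(i < m | (i < p)%N) c i * v 0 i| <= p%:R * e * `|v|.
  have := H m (leqnn m); rewrite wm; congr (`|_ - _| <= _).
  by apply: eq_bigl => i; rewrite ltn_ord.
elim: p => [_|p IH pm].
  by rewrite w0 addr0 subrr sub0r big_pred0// oppr0 normr0 !mul0r.
pose i := Ordinal pm.
have wS : w p.+1 = v 0 i *: delta_mx 0 i + w p.
  apply/rowP => j; rewrite !mxE eqxx ltnS leq_eqVlt /=.
  have [->|ji] := eqVneq j i; first by rewrite eqxx ltnn mulr1 addr0.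
  by rewrite -val_eqE/= in ji; rewrite (negbTE ji) mulr0 add0r.
(* The norm is the sup norm: truncating [v] or shrinking one coordinate does not increase it, so the
   path stays where the hypotheses hold. *)
have sub s : `|s| <= `|v 0 i| -> `|s *: delta_mx 0 i + (x + w p) - x| <= `|v|.
  move=> sv; have -> : s *: delta_mx 0 i + (x + w p) - x =
      s *: delta_mx 0 i + w p by rewrite addrCA [LHS]addrC addKr.
  apply: norm_rV_le => // j.
  rewrite !mxE eqxx/=; have [->|ji] := eqVneq j i.
    by rewrite mulr1 ltnn addr0 (le_trans sv)// coord_le_norm.
  by rewrite mulr0 add0r; case: ifP => _; rewrite ?normr0// coord_le_norm.
have := @mean_value_le R (fun s => f (s *: delta_mx 0 i + (x + w p)))
  (fun s => partial i f (s *: delta_mx 0 i + (x + w p))) (v 0 i) (c i) e.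
rewrite scale0r add0r => step.
have {}step := step (fun s h => is_derive_line (df _ i (sub s h)))
  (fun s h => dfc _ i (sub s h)).
rewrite (bigD1 i)//= (eq_bigl (fun j : 'I_m => (j < p)%N)); last first.
  move=> j; rewrite -val_eqE/= ltnS [in LHS]leq_eqVlt.
  by have [->|] := eqVneq (val j) p; rewrite ?ltnn ?andbT.
rewrite wS addrCA -[p.+1]addn1 natrD !mulrDl mul1r.
set S := \sum_(_ < _ | _) _; set a := f _.
have -> : a - f x - (c i * v 0 i + S) =
   (f (x + w p) - f x - S) + (a - f (x + w p) - c i * v 0 i) by ring.
apply: (le_trans (ler_normD _ _)); apply: lerD; first exact/IH/ltnW.
apply: (le_trans step); rewrite ler_wpM2l ?coord_le_norm//.
(* [e] is nonnegative because it bounds a norm at [x] itself. *)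
apply: le_trans (dfc x i _); first exact: normr_ge0.
by rewrite subrr normr0.
Qed.

(** The candidate differential; its coefficients will be the partial derivatives at the base
    point. *)
Definition row_form (R : realType) (m : nat) (c : 'I_m -> R) (v : 'rV[R]_m) : R :=
  \sum_(i < m) c i * v 0 i.

Lemma row_form_linear (R : realType) (m : nat) (c : 'I_m -> R) :
  linear (row_form c : 'rV[R]_m -> R).
Proof.
move=> a u v; rewrite /row_form scaler_sumr -big_split/=; apply: eq_bigr => i _.
by rewrite !mxE mulrDr; congr (_ + _); exact: mulrCA.
Qed.

HB.instance Definition _ (R : realType) (m : nat) (c : 'I_m -> R) :=
  GRing.isLinear.Build R 'rV[R]_m R _ (row_form c) (row_form_linear c).

Lemma row_form_continuous (R : realType) (m : nat) (c : 'I_m -> R) :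
  continuous (row_form c : 'rV[R]_m -> R).
Proof.
move=> x; apply: (@cvg_sumr _ _ _ _ (nbhs_filter x)) => i.
by apply: (@cvgMl_tmp _ _ _ (nbhs_filter x)); exact: coord_continuous.
Qed.

(** [differentiable] speaks of the chosen differential ['d f x]; uniqueness of the first order
    expansion identifies it with [df]. *)
Lemma differentiable_littleo (K : numFieldType) (V W : normedModType K)
    (f : V -> W) (df : {linear V -> W}) (x : V) : continuous df ->
  (forall e, 0 < e ->
     \forall v \near (0 : V), `|f (v + x) - f x - df v| <= e * `|v|) ->
  differentiable f x.
Proof.
move=> cdf H; have dfE : f \o shift x = cst (f x) + df +o_ 0 id.
  apply/eqaddoP => e /H; apply: filterS => v /=.
  by rewrite !fctE /= opprD addrA.
by apply/diff_locallyP; have -> := diff_unique cdf dfE.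
Qed.

(** Class C^k is given through partial derivatives only, whereas the chain rule through the
    inversion needs a total derivative. The error of the linear approximation is controlled by the
    oscillation of the partial derivatives near [x]. *)
Lemma C1_differentiable (R : realType) (m : nat) (f : 'rV[R]_m -> R)
    (x : 'rV[R]_m) :
  (\forall z \near x, forall i, derivable f z (delta_mx 0 i)) ->
  (forall i, {for x, continuous (partial i f)}) -> differentiable f x.
Proof.
move=> df cf; pose c i := partial i f x.
apply: (@differentiable_littleo R _ _ f (row_form c)) => [|e e0].
  exact: row_form_continuous.
(* Each of the [m] coordinate moves of [increment_le] costs this much; [m.+1] also covers
   [m = 0]. *)
have e1 : 0 < e / m.+1%:R by rewrite divr_gt0.
have : \forall z \near x, forall i, derivable f z (delta_mx 0 i) /\
    `|partial i f z - c i| <= e / m.+1%:R.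
  near=> z => i; split; first by move: i; near: z.
  move: i; near: z; apply: filter_forall => i.
  have /cvgrPdist_le/(_ _ e1) := cf i.
  by apply: filterS => z; rewrite distrC.
move=> /nbhs_ballP[d /= d0 H]; apply/nbhs_ballP; exists d => //= v.
rewrite -ball_normE/= sub0r normrN => vd.
have xzP z : `|z - x| <= `|v| -> ball x d z.
  by rewrite -ball_normE/= distrC => /le_lt_trans; apply.
have := @increment_le R m f x v c (e / m.+1%:R)
  (fun z i h => (H z (xzP z h) i).1) (fun z i h => (H z (xzP z h) i).2).
rewrite [x + v]addrC => /le_trans; apply.
rewrite ler_wpM2r// mulrCA ger_pMr// ler_pdivrMr// mul1r ler_nat.
exact: leqnSn.
Unshelve. all: by end_near. Qed.

(** * Taylor remainders at the origin *)

(* Bounding |f y| at every scale L >= |y| rather than at L = |y| spares a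
   separate treatment of y = 0. *)
Definition bigO0 (R : realType) (m : nat) (f : 'rV[R]_m -> R) (k : nat) :=
  exists C d : R, [/\ 0 <= C, 0 < d & forall (y : 'rV[R]_m) L,
    `|y| <= L -> 0 < L < d -> `|f y| <= C * L ^+ k].

Definition littleo0 (R : realType) (m : nat) (f : 'rV[R]_m -> R) (k : nat) :=
  forall e : R, 0 < e -> exists2 d : R, 0 < d & forall (y : 'rV[R]_m) L,
    `|y| <= L -> 0 < L < d -> `|f y| <= e * L ^+ k.

(** A sequence of functions instead of the iterated derivatives of one: [phi j] will be the [j]-th
    iterated partial derivative restricted to a line. *)
Definition derivative_chain (R : realType) (a b : R) (m : nat)
    (phi : nat -> R -> R) :=
  forall j (s : R), (j < m)%N -> s \in `[a, b] ->
    is_derive s 1 (phi j) (phi j.+1 s).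

Lemma derivative_chain_sub (R : realType) (a b a' b' : R) (m m' : nat)
    (phi : nat -> R -> R) : a <= a' -> b' <= b -> (m' <= m)%N ->
  derivative_chain a b m phi -> derivative_chain a' b' m' phi.
Proof.
move=> aa bb mm H j s jm; rewrite in_itv/= => /andP[as' sb].
by apply: H; rewrite ?(leq_trans jm)// in_itv/= (le_trans aa)// (le_trans sb).
Qed.

Lemma derivative_chain_mean (R : realType) (a b : R) (m : nat)
    (phi : nat -> R -> R) (j : nat) (x y : R) : derivative_chain a b m phi ->
  (j < m)%N -> a <= x -> x <= y -> y <= b ->
  exists2 s, s \in `[x, y] & phi j y - phi j x = phi j.+1 s * (y - x).
Proof.
move=> H jm ax xy yb.
have sub s : s \in `[x, y] -> s \in `[a, b].
  by rewrite !in_itv/= => /andP[xs sy]; rewrite (le_trans ax)// (le_trans sy).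
apply: MVT_segment => // [s sxy|].
  exact: H jm (sub s (subset_itv_oo_cc sxy)).
apply: derivable_within_continuous => s /sub sab.
by have [] := H _ _ jm sab.
Qed.

(** In each outer third of the interval the induction gives a point where [phi j] is small. These
    points are at least a third of the length apart, so the mean value theorem between them yields a
    point where [phi j.+1] is small. *)
Lemma small_derivative_point (R : realType) (j : nat) :
  exists2 K : R, 0 <= K & forall (phi : nat -> R -> R) (a b A : R), a < b ->
    derivative_chain a b j phi ->
    (forall s, s \in `[a, b] -> `|phi 0 s| <= A) ->
    exists2 s, s \in `[a, b] & `|phi j s| <= A * K / (b - a) ^+ j.
Proof.
elim: j => [|j [K K0 IH]].
  exists 1 => // phi a b A ab _ phiA; exists a; last first.
    by rewrite mulr1 divr1 phiA// in_itv/= lexx ltW.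
  by rewrite in_itv/= lexx ltW.
(* Two values of size [A * K * (3 / L) ^+ j], divided by a distance [L / 3]. *)
exists (6 * K * 3 ^+ j); first by rewrite !mulr_ge0// exprn_ge0.
move=> phi a b A ab dphi phiA.
pose L := b - a; have L0 : 0 < L by rewrite subr_gt0.
pose x := a + L / 3; pose y := b - L / 3.
have ax : a < x by rewrite ltrDl divr_gt0.
have yb : y < b by rewrite ltrBlDr ltrDl divr_gt0.
have xy : y - x = L / 3 by rewrite /x /y /L; field.
have xley : x <= y by rewrite -subr_ge0 xy divr_ge0// ltW.
have A0 : 0 <= A by rewrite (le_trans _ (phiA a _))// in_itv/= lexx ltW.
have [|s|s1 s1P phis1] := IH phi a x A ax.
- apply: derivative_chain_sub dphi => //; exact: le_trans xley (ltW yb).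
- rewrite in_itv/= => /andP[a_s sx]; apply: phiA; rewrite in_itv/= a_s/=.
  by rewrite (le_trans sx)// (le_trans xley)// ltW.
have [|s|s2 s2P phis2] := IH phi y b A yb.
- apply: derivative_chain_sub dphi => //; exact: le_trans (ltW ax) xley.
- rewrite in_itv/= => /andP[ys sb]; apply: phiA; rewrite in_itv/= sb andbT.
  by rewrite (le_trans (ltW ax))// (le_trans xley).
move: s1P s2P; rewrite !in_itv/= => /andP[as1 s1x] /andP[ys2 s2b].
have s12 : L / 3 <= s2 - s1 by rewrite -xy lerB.
have s12' : s1 <= s2 by rewrite -subr_ge0 (le_trans _ s12)// divr_ge0// ltW.
have [s sP E] := derivative_chain_mean dphi (ltnSn j) as1 s12' s2b.
exists s.
  move: sP; rewrite !in_itv/= => /andP[s1s ss2].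
  by rewrite (le_trans as1)// (le_trans ss2).
rewrite -/L in phis1 phis2 *.
have xa : x - a = L / 3 by rewrite /x addrAC subrr add0r.
have by' : b - y = L / 3 by rewrite /y opprB addrCA subrr addr0.
rewrite xa in phis1; rewrite by' in phis2.
have B : `|phi j.+1 s| * (L / 3) <= (A * K / (L / 3) ^+ j) *+ 2.
  apply: (@le_trans _ _ (`|phi j.+1 s| * (s2 - s1))).
    by rewrite ler_wpM2l.
  rewrite -[X in _ * X]ger0_norm ?subr_ge0// -normrM -E mulr2n.
  by rewrite (le_trans (ler_normB _ _))// lerD.
rewrite -(@ler_pM2r _ (L / 3)) ?divr_gt0//; apply: (le_trans B).
rewrite le_eqVlt; apply/orP; left; apply/eqP.
rewrite expr_div_n exprS invf_div mulr2n; field.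
by rewrite expf_neq0 ?gt_eqF//=.
Qed.

(* A Landau-Kolmogorov inequality at the scale L. *)
Lemma derivative_chain_bound (R : realType) (m : nat) (C M : R) :
  0 <= C -> 0 <= M ->
  forall i, (i <= m)%N -> exists2 K : R, 0 <= K &
    forall (phi : nat -> R -> R) L, 0 < L -> derivative_chain 0 L m phi ->
    (forall s, s \in `[0, L] -> `|phi 0 s| <= C * L ^+ m) ->
    (forall s, s \in `[0, L] -> `|phi m s| <= M) ->
    forall s, s \in `[0, L] -> `|phi (m - i)%N s| <= K * L ^+ i.
Proof.
(* Descending induction on the order [m - i], from the bound [M] on the derivative of order [m]. *)
move=> C0 M0; elim => [_|i IH im].
  by exists M => // phi L L0 _ _ H s sL; rewrite subn0 expr0 mulr1; exact: H.
have [K K0 HK] := IH (ltnW im).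
have [K1 K10 HK1] := small_derivative_point R (m - i.+1).
(* [C * K1] bounds the derivative at one good point; [K], through the next derivative, bounds its
   variation over a length at most [L]. *)
exists (C * K1 + K); first by rewrite addr_ge0// mulr_ge0.
move=> phi L L0 dphi phi0 phim s sL.
set j := (m - i.+1)%N in HK1 *.
have jE : (m - i = j.+1)%N by rewrite /j subnSK.
have jm : (j < m)%N by rewrite -jE leq_subr.
have [||s1 s1L phis1] := HK1 phi 0 L (C * L ^+ m) L0.
- exact: derivative_chain_sub (ltnW jm) dphi.
- exact: phi0.
have {}phis1 : `|phi j s1| <= C * K1 * L ^+ i.+1.
  apply: (le_trans phis1); rewrite subr0 -(subnK im) -/j exprD.
  rewrite le_eqVlt; apply/orP; left; apply/eqP; field.
  by rewrite expf_neq0// gt_eqF.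
have bnd u : u \in `[0, L] -> `|phi j.+1 u| <= K * L ^+ i.
  by rewrite -jE; exact: HK.
have step u w : u \in `[0, L] -> w \in `[0, L] -> u <= w ->
    `|phi j w - phi j u| <= K * L ^+ i.+1.
  rewrite !in_itv/= => /andP[u0 uL] /andP[w0 wL] uw.
  have [t tuw ->] := derivative_chain_mean dphi jm u0 uw wL.
  rewrite normrM exprSr mulrA ler_pM//.
    apply: bnd; move: tuw; rewrite !in_itv/= => /andP[ut tw].
    by rewrite (le_trans u0)// (le_trans tw).
  by rewrite ger0_norm ?subr_ge0// (le_trans _ wL)// gerBl.
rewrite mulrDl -[phi j s](subrK (phi j s1)) addrC.
rewrite (le_trans (ler_normD _ _))// lerD//.
have [ss1|/ltW s1s] := leP s s1; last exact: step.
by rewrite distrC; exact: step.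
Qed.

(** * Regularity of iterated partial derivatives *)

Section Ck_facts.
Variables (R : realType) (m : nat) (U : set 'rV[R]_m).
Implicit Types f : 'rV[R]_m -> R.

Lemma Ck_continuous k f x : Ck k U f -> U x -> {for x, continuous f}.
Proof. by case: k => [|k] [cf _]; exact: cf. Qed.

Lemma Ck_derivable k f i x : Ck k.+1 U f -> U x ->
  derivable f x (delta_mx 0 i).
Proof. by move=> [_ /(_ i)[df _]]; exact: df. Qed.

Lemma Ck_partial k f i : Ck k.+1 U f -> Ck k U (partial i f).
Proof. by move=> [_ /(_ i)[_]]. Qed.

Lemma Ck_iter_partial k j f i : Ck (j + k) U f -> Ck k U (iter j (partial i) f).
Proof.
elim: j k f => [//|j IH] k f; rewrite iterSr => H; apply: IH.
exact: Ck_partial.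
Qed.

Lemma Ck_differentiable k f x : open U -> Ck k.+1 U f -> U x ->
  differentiable f x.
Proof.
move=> oU Cf Ux; apply: C1_differentiable => [|i].
  near=> z => i; apply: Ck_derivable Cf _; near: z.
  exact: open_nbhs_nbhs.
exact: Ck_continuous (Ck_partial i Cf) Ux.
Unshelve. all: by end_near. Qed.

End Ck_facts.

Lemma Ck_sub (R : realType) (m : nat) (U V : set 'rV[R]_m) k f :
  V `<=` U -> Ck k U f -> Ck k V f.
Proof.
move=> VU; elim: k f => [|k IH] f [cf H]; split => //.
- by move=> x /VU; exact: cf.
- by move=> x /VU; exact: cf.
- move=> i; have [df Cf] := H i; split; last exact: IH.
  by move=> x /VU; exact: df.
Qed.

(** Interpolation along a segment of length [L] from [y] in direction [i]: there [f] is small by its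
    decay, and its iterated partial derivative of order [m.+1] is bounded by continuity at 0. *)
Lemma bigO0_partial (R : realType) (n m : nat) (d : R) (f : 'rV[R]_n -> R) i :
  0 < d -> Ck m.+1 [set y | `|y| < d] f -> bigO0 f m.+1 ->
  bigO0 (partial i f) m.
Proof.
move=> d0 Cf [C [d1 [C0 d10 fC]]].
have C0f : Ck 0 [set y : 'rV[R]_n | `|y| < d] (iter m.+1 (partial i) f).
  by apply: Ck_iter_partial; rewrite addn0.
have cf : {for 0, continuous (iter m.+1 (partial i) f)}.
  by apply: Ck_continuous C0f _; rewrite /= normr0.
set g := iter m.+1 (partial i) f in C0f cf.
have : \forall z \near (0 : 'rV[R]_n), `|g 0 - g z| < 1.
  by move/cvgrPdist_lt : cf => /(_ _ ltr01).
move=> /nbhs_ballP[d2 /= d20 gd2].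
have M0 : 0 <= `|g 0| + 1 by rewrite addr_ge0.
(* The segment stays within norm [2 * L], whence the factor [2 ^+ m.+1]. The bound is taken at index
   [m], that is for the derivative of order [m.+1 - m = 1]. *)
have [K K0 HK] := derivative_chain_bound
  (mulr_ge0 C0 (exprn_ge0 m.+1 (ltW (ltr0Sn R 1)))) M0 (leqnSn m).
exists K, (Num.min d (Num.min d1 d2) / 2); split => //.
  by rewrite divr_gt0// !lt_min d0 d10.
move=> y L yL /andP[L0]; rewrite ltr_pdivlMr// !lt_min => /and3P[Ld Ld1 Ld2].
have nL s : s \in `[0, L] -> `|s *: delta_mx 0 i + y| <= L * 2.
  rewrite in_itv/= => /andP[s0 sL].
  rewrite (le_trans (ler_normD _ _))// mulr_natr mulr2n lerD// normrZ ger0_norm//.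
  by rewrite -[leRHS]mulr1 ler_pM// norm_delta_le.
pose phi j s := iter j (partial i) f (s *: delta_mx 0 i + y).
have := HK phi L L0 _ _ _ 0; rewrite subSn// subnn /phi/= scale0r add0r.
apply; last by rewrite in_itv/= lexx ltW.
- move=> j s jm sL; apply: is_derive_line.
  apply: (@Ck_derivable _ _ [set y | `|y| < d] (m - j)).
    by apply: Ck_iter_partial; rewrite addnS subnKC.
  exact: le_lt_trans (nL s sL) Ld.
- move=> s sL; rewrite -mulrA -exprMn [2 * L]mulrC; apply: fC; first exact: nL.
  by rewrite Ld1 mulr_gt0.
- move=> s sL; rewrite -[X in `|X|](subrK (g 0)) addrC.
  rewrite (le_trans (ler_normD _ _))// lerD2l distrC ltW//; apply: gd2.
  by rewrite -ball_normE/= sub0r normrN (le_lt_trans (nL s sL)).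
Qed.

(** Proved on a line with the one-variable chain rule, since only derivability in the direction [v]
    is assumed. *)
Lemma derive_antipode (R : realType) (n : nat) (f : 'rV[R]_n -> R) (y v : 'rV[R]_n) :
  derivable f (- y) v -> is_derive y v (fun z => f (- z)) (- 'D_v f (- y)).
Proof.
move=> df.
have : is_derive (0 : R) (1 : R) ((fun t : R => f (t *: v + - y)) \o -%R)
    ('D_v f (- y) * -1).
  apply: is_derive1_comp; rewrite oppr0; have := @is_derive_line R n f (- y) v 0.
  by rewrite scale0r add0r; exact.
have -> : (fun t : R => f (t *: v + - y)) \o -%R =
    (fun t : R => f (- (t *: v + y))).
  by apply/funext => t /=; rewrite scaleNr opprD.
rewrite mulrN1 => -[d1 d2].
have dF : derivable (fun z => f (- z)) y v.
  exact: (iffRL (derivable1P (fun z => f (- z)) y v) d1).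
apply: DeriveDef => //; rewrite -d2.
have := @is_derive_line R n (fun z => f (- z)) y v 0.
by rewrite scale0r add0r => /(_ dF)[_ ->].
Qed.

(** Twice the part of [f] whose parity is opposite to that of [m]; it vanishes on homogeneous
    polynomials of degree [m]. *)
Definition antipodal (R : realType) (n m : nat) (f : 'rV[R]_n -> R)
  (y : 'rV[R]_n) : R := f y - (-1) ^+ m * f (- y).

Lemma littleo0_uniform (R : realType) (n m : nat) (I : finType)
    (f : I -> 'rV[R]_n -> R) : (forall i, littleo0 (f i) m) ->
  forall e : R, 0 < e -> exists2 d : R, 0 < d & forall i (y : 'rV[R]_n) L,
    `|y| <= L -> 0 < L < d -> `|f i y| <= e * L ^+ m.
Proof.
move=> fo e e0.
suff : \forall d \near (0 : R)^'+, 0 < d /\ forall i (y : 'rV[R]_n) L,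
    `|y| <= L -> 0 < L < d -> `|f i y| <= e * L ^+ m.
  by move=> /filter_ex[d [d0 Hd]]; exists d.
near=> d; split; first by near: d; exact: nbhs_right_gt.
near: d; apply: filter_forall => i; have [d d0 Hd] := fo i _ e0.
apply: filterS (nbhs_right_lt d0) => d' d'd y L yL /andP[L0 Ld].
by apply: Hd => //; rewrite L0 (lt_trans Ld).
Unshelve. all: by end_near. Qed.

(* By induction on m: antipodal m.+1 f has partial derivatives
   antipodal m (partial i f). *)
Lemma littleo0_antipodal (R : realType) (n m : nat) (d : R) (f : 'rV[R]_n -> R) :
  0 < d -> Ck m [set y | `|y| < d] f -> bigO0 f m -> littleo0 (antipodal m f) m.
Proof.
move=> d0; elim: m f => [|m IH] f Cf fO e e0.
  have e20 : 0 < e / 2 by rewrite divr_gt0.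
  have cf : {for 0, continuous f} by apply: Ck_continuous Cf _; rewrite /= normr0.
  have : \forall z \near (0 : 'rV[R]_n), `|f 0 - f z| < e / 2.
    by move/cvgrPdist_lt : cf => /(_ _ e20).
  move=> /nbhs_ballP[d2 /= d20 fd2]; exists d2 => // y L yL /andP[L0 Ld].
  have yd : `|y| < d2 by exact: le_lt_trans yL Ld.
  rewrite /antipodal expr0 mul1r mulr1 (splitr e).
  rewrite -[X in `|X|](subrKA (f 0)) (le_trans (ler_normD _ _))// lerD// ltW//.
    by rewrite distrC fd2// -ball_normE/= sub0r normrN.
  by rewrite fd2// -ball_normE/= sub0r !normrN.
have {}IH i : littleo0 (antipodal m (partial i f)) m.
  by apply: IH; [exact: Ck_partial|exact: (bigO0_partial i d0 Cf fO)].
have e1 : 0 < e / n.+1%:R by rewrite divr_gt0.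
have [D D0 HD] := littleo0_uniform IH e1.
exists (Num.min d D); first by rewrite lt_min d0.
move=> y L yL /andP[L0]; rewrite lt_min => /andP[Ld LD].
have f0 : f 0 = 0.
  have [C [d1 [C0 d10 fC]]] := fO.
  apply/eqP; rewrite -normr_le0; apply/ler_addgt0Pr => t t0; rewrite add0r.
  (* A scale at which the decay applies to the point 0: below [d1], at most 1 so that
     [l ^+ m.+1 <= l], and with [l * (C + 1) <= t]. *)
  pose l := Num.min (d1 / 2) (Num.min 1 (t / (C + 1))).
  have C1 : 0 < C + 1 by rewrite ltr_wpDl.
  have l0 : 0 < l by rewrite !lt_min !divr_gt0//= ltr01.
  have ld : l < d1 by rewrite !gt_min ltr_pdivrMr// ltr_pMr// ltr1n.
  have l1 : l <= 1 by rewrite !ge_min lexx !orbT.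
  have lt : l * (C + 1) <= t by rewrite -ler_pdivlMr// !ge_min lexx !orbT.
  have := fC 0 l; rewrite normr0 (ltW l0) l0 ld => /(_ isT isT) /le_trans; apply.
  apply: le_trans lt; rewrite mulrC exprS ler_pM//.
  - by rewrite mulr_ge0// ?exprn_ge0// ltW.
  - by rewrite ler_piMr// ?exprn_ile1// ltW.
  - by rewrite lerDl.
(* Comparison with zero slopes: the function vanishes at 0 and its partial derivatives are
   [o(L ^+ m)], so the increment gains one factor [L]. *)
have := @increment_le R n (antipodal m.+1 f) 0 y (fun=> 0) (e / n.+1%:R * L ^+ m).
rewrite add0r big1 => [H|i _]; last by rewrite mul0r.
have df (z : 'rV[R]_n) i : `|z - 0| <= `|y| -> is_derive z (delta_mx 0 i)
    (antipodal m.+1 f) (antipodal m (partial i f) z).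
  rewrite subr0 => zy.
  have zd : `|z| < d by rewrite (le_lt_trans zy)// (le_lt_trans yL).
  have nzd : `|- z| < d by rewrite normrN.
  have dz := is_deriveB (derivableP (@Ck_derivable _ _ _ _ _ i _ Cf zd))
    (is_deriveZ ((-1) ^+ m.+1) (derive_antipode (@Ck_derivable _ _ _ _ _ i _ Cf nzd))).
  apply: (is_derive_eq dz); rewrite /antipodal /partial exprS mulN1r scaleNr scalerN.
  by rewrite opprK.
have f0y : antipodal m.+1 f 0 = 0 by rewrite /antipodal oppr0 f0 mulr0 subr0.
rewrite f0y !subr0 in H.
have Hz (z : 'rV[R]_n) i : `|z - 0| <= `|y| ->
    `|partial i (antipodal m.+1 f) z - 0| <= e / n.+1%:R * L ^+ m.
  move=> zy; have dz := df z i zy; rewrite /partial derive_val subr0.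
  by apply: HD; rewrite ?L0//; move: zy; rewrite subr0 => /le_trans; apply.
apply: le_trans (H _ Hz) _.
  by move=> z i zy; have [] := df z i zy.
have L0' := ltW L0; rewrite exprSr [leRHS]mulrA ler_pM//.
  by rewrite !mulr_ge0 ?exprn_ge0 ?invr_ge0 ?ler0n// ltW.
rewrite mulrA ler_wpM2r ?exprn_ge0// mulrCA ger_pMr// ler_pdivrMr// mul1r ler_nat.
exact: leqnSn.
Qed.

(** * The inversion *)

Section pointwise_rules.
Variables (R : realType) (m : nat).
Implicit Types (f g : 'rV[R]_m -> R) (x v : 'rV[R]_m).

Lemma continuous_mul f g x : {for x, continuous f} -> {for x, continuous g} ->
  {for x, continuous (fun z => f z * g z)}.
Proof. exact: continuousM. Qed.

Lemma continuous_add f g x : {for x, continuous f} -> {for x, continuous g} ->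
  {for x, continuous (fun z => f z + g z)}.
Proof. exact: continuousD. Qed.

Lemma continuous_sub f g x : {for x, continuous f} -> {for x, continuous g} ->
  {for x, continuous (fun z => f z - g z)}.
Proof. exact: continuousB. Qed.

Lemma continuous_inv f x : f x != 0 -> {for x, continuous f} ->
  {for x, continuous (fun z => (f z)^-1)}.
Proof. exact: continuousV. Qed.

Lemma continuous_sum (I : finType) (f : I -> 'rV[R]_m -> R) x :
  (forall i, {for x, continuous (f i)}) ->
  {for x, continuous (fun z => \sum_i f i z)}.
Proof. by move=> cf; apply: (@cvg_sumr _ _ _ _ (nbhs_filter x)). Qed.

Lemma continuous_const (c : R) x : {for x, continuous (fun=> c)}.
Proof. exact: cst_continuous. Qed.

Lemma is_derive_mul f g x v (df dg : R) : is_derive x v f df ->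
  is_derive x v g dg ->
  is_derive x v (fun z => f z * g z) (df * g x + f x * dg).
Proof.
move=> Hf Hg; apply: (is_derive_eq (is_deriveM Hf Hg)).
by rewrite addrC [_ *: df]mulrC.
Qed.

Lemma is_derive_add f g x v (df dg : R) : is_derive x v f df ->
  is_derive x v g dg -> is_derive x v (fun z => f z + g z) (df + dg).
Proof. exact: is_deriveD. Qed.

Lemma is_derive_inv f x v (df : R) : f x != 0 -> is_derive x v f df ->
  is_derive x v (fun z => (f z)^-1) (- df / f x ^+ 2).
Proof.
move=> f0 [df1 df2]; apply: DeriveDef; first exact: derivableV.
by rewrite deriveV// df2 [_ *: _]mulrC mulrN mulNr.
Qed.

Lemma is_derive_sumr (I : finType) (f : I -> 'rV[R]_m -> R) x v (df : I -> R) :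
  (forall i, is_derive x v (f i) (df i)) ->
  is_derive x v (fun z => \sum_i f i z) (\sum_i df i).
Proof.
move=> Hf; elim: (index_enum I) => [|i r IH].
  rewrite big_nil; under eq_fun do rewrite big_nil.
  exact: is_derive_cst.
rewrite big_cons; under eq_fun do rewrite big_cons.
exact: is_derive_add.
Qed.

Lemma is_derive_coord x v a : is_derive x v (fun z : 'rV[R]_m => z 0 a) (v 0 a).
Proof.
apply: DeriveDef; first exact/diff_derivable/differentiable_coord.
by have := @derive_mx R _ 1 m id x v (@derivable_id _ _ x v);
  rewrite derive_id => {2}->; rewrite mxE.
Qed.

End pointwise_rules.

Section inversion.
Variables (R : realType) (n : nat).
Implicit Types x y : 'rV[R]_n.

Definition sqnorm x : R := \sum_(i < n) x 0 i ^+ 2.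

Lemma sqnorm_ge0 x : 0 <= sqnorm x.
Proof. by apply: sumr_ge0 => i _; exact: sqr_ge0. Qed.

Lemma enorm_sqr x : enorm x ^+ 2 = sqnorm x.
Proof. exact/sqr_sqrtr/sqnorm_ge0. Qed.

Lemma enorm_ge0 x : 0 <= enorm x. Proof. exact: sqrtr_ge0. Qed.

Lemma coord_le_enorm x i : `|x 0 i| <= enorm x.
Proof.
rewrite -(@ler_pXn2r _ 2)// ?nnegrE ?enorm_ge0// enorm_sqr /sqnorm.
rewrite real_normK ?num_real// (bigD1 i)//= lerDl.
by apply: sumr_ge0 => j _; exact: sqr_ge0.
Qed.

Lemma norm_le_enorm x : `|x| <= enorm x.
Proof. by apply: norm_rV_le => [|i]; [exact: enorm_ge0|exact: coord_le_enorm]. Qed.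

(** A crude factor, from [n <= n ^ 2]; only the equivalence of the two norms matters. *)
Lemma enorm_le_norm x : enorm x <= n%:R * `|x|.
Proof.
rewrite -(@ler_pXn2r _ 2)// ?nnegrE ?enorm_ge0 ?mulr_ge0// enorm_sqr.
apply: (@le_trans _ _ (\sum_(i < n) `|x| ^+ 2)).
  apply: ler_sum => i _; rewrite -[x 0 i ^+ 2]real_normK ?num_real//.
  by rewrite ler_pXn2r// ?nnegrE// coord_le_norm.
rewrite sumr_const card_ord exprMn -[leLHS]mulr_natl ler_wpM2r ?exprn_ge0//.
by rewrite -natrX ler_nat; case: (n) => // k; rewrite expnS expn1 leq_pmulr.
Qed.

Lemma enormZ (c : R) x : enorm (c *: x) = `|c| * enorm x.
Proof.
rewrite /enorm -sqrtr_sqr -sqrtrM ?sqr_ge0//; congr Num.sqrt.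
by rewrite mulr_sumr; apply: eq_bigr => i _; rewrite mxE exprMn.
Qed.

Lemma enormN x : enorm (- x) = enorm x.
Proof. by rewrite -scaleN1r enormZ normrN1 mul1r. Qed.

Lemma enorm_inversion x : 0 < enorm x -> enorm (inversion x) = (enorm x)^-1.
Proof.
move=> x0; rewrite enormZ ger0_norm ?invr_ge0 ?exprn_ge0 ?enorm_ge0//.
by field; rewrite gt_eqF.
Qed.

Lemma inversionN x : inversion (- x) = - inversion x.
Proof. by rewrite /inversion enormN scalerN. Qed.

Lemma inversionE x i : inversion x 0 i = x 0 i / sqnorm x.
Proof. by rewrite mxE enorm_sqr mulrC. Qed.

(* The Jacobian matrix of the inversion at x is the reflection in the
   hyperplane orthogonal to x, divided by |x|^2. *)
Definition reflection x (a b : 'I_n) : R :=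
  (a == b)%:R - 2 * x 0 a * x 0 b / sqnorm x.

(** The partial derivative along [j] of the entry [(a, b)] of the reflection; it is odd and
    homogeneous of degree -1 in [x]. *)
Definition dreflection (j : 'I_n) x (a b : 'I_n) : R :=
  - 2 * ((j == a)%:R * x 0 b + (j == b)%:R * x 0 a) / sqnorm x
  + 4 * x 0 a * x 0 b * x 0 j / sqnorm x ^+ 2.

Lemma sqnormN x : sqnorm (- x) = sqnorm x.
Proof. by apply: eq_bigr => i _; rewrite mxE sqrrN. Qed.

Lemma reflectionN x a b : reflection (- x) a b = reflection x a b.
Proof. by rewrite /reflection sqnormN !mxE; ring. Qed.

Lemma dreflectionN j x a b : dreflection j (- x) a b = - dreflection j x a b.
Proof. by rewrite /dreflection sqnormN !mxE; ring. Qed.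

Lemma sqnorm_gt0 x : 0 < enorm x -> 0 < sqnorm x.
Proof. by rewrite -enorm_sqr => ?; rewrite exprn_gt0. Qed.

(** A reflection is symmetric and orthogonal; this is why the inversion preserves the flat part of
    the metric up to a conformal factor. *)
Lemma reflection_involutive x a b : 0 < enorm x ->
  \sum_c reflection x a c * reflection x b c = (a == b)%:R.
Proof.
move=> /sqnorm_gt0; rewrite lt0r => /andP[s0 _].
have E c : reflection x a c * reflection x b c =
    (a == c)%:R * (b == c)%:R
    - 2 * x 0 a / sqnorm x * ((b == c)%:R * x 0 c)
    - 2 * x 0 b / sqnorm x * ((a == c)%:R * x 0 c)
    + 4 * x 0 a * x 0 b / sqnorm x ^+ 2 * (x 0 c ^+ 2).
  by rewrite /reflection; field.
under eq_bigr do rewrite E.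
rewrite !(big_split, sumrN, sumrB)/= -!mulr_sumr -/(sqnorm x).
have D (e : 'I_n) (F : 'I_n -> R) : \sum_c (e == c)%:R * F c = F e.
  rewrite (bigD1 e)//= eqxx mul1r big1 ?addr0// => i ie.
  by rewrite eq_sym (negbTE ie) mul0r.
rewrite !D eq_sym; field.
by [].
Qed.

Lemma ler_norm_div x i : 0 < enorm x -> `|x 0 i / enorm x| <= 1.
Proof.
move=> x0; rewrite normrM [X in _ * X]ger0_norm ?invr_ge0 ?enorm_ge0//.
by rewrite ler_pdivrMr// mul1r coord_le_enorm.
Qed.

Lemma reflection_le x a b : 0 < enorm x -> `|reflection x a b| <= 3.
Proof.
move=> x0; rewrite /reflection -enorm_sqr.
have -> : 2 * x 0 a * x 0 b / enorm x ^+ 2 =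
    2 * ((x 0 a / enorm x) * (x 0 b / enorm x)) by field; rewrite gt_eqF.
have E : (3 : R) = 1 + 2 * (1 * 1) by ring.
rewrite E (le_trans (ler_normB _ _))// lerD//.
  by case: (_ == _); rewrite ?normr1 ?normr0.
by rewrite normrM ger0_norm// ler_wpM2l// normrM ler_pM// ler_norm_div.
Qed.

(** By homogeneity one factor [1 / enorm x] splits off. The normalized coordinates lie in [-1, 1],
    and the two terms contribute [2 * (1 + 1)] and [4]. *)
Lemma dreflection_le j x a b : 0 < enorm x ->
  `|dreflection j x a b| <= 8 / enorm x.
Proof.
move=> x0; rewrite /dreflection -enorm_sqr.
set p := x 0 a / enorm x; set q := x 0 b / enorm x; set r := x 0 j / enorm x.
have -> : - 2 * ((j == a)%:R * x 0 b + (j == b)%:R * x 0 a) / enorm x ^+ 2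
    + 4 * x 0 a * x 0 b * x 0 j / (enorm x ^+ 2) ^+ 2 =
    (- 2 * ((j == a)%:R * q + (j == b)%:R * p) + 4 * (p * q * r)) / enorm x.
  by rewrite /p /q /r; field; rewrite gt_eqF.
have [p1 q1 r1] : [/\ `|p| <= 1, `|q| <= 1 & `|r| <= 1].
  by split; exact: ler_norm_div.
clearbody p q r.
have B (c : bool) t : `|t| <= 1 -> `|c%:R * t| <= 1 :> R.
  by case: c => t1; rewrite ?mul1r// mul0r normr0.
rewrite normrM [X in _ * X]ger0_norm ?invr_ge0 ?enorm_ge0//.
rewrite ler_wpM2r ?invr_ge0 ?enorm_ge0//.
have -> : (8 : R) = 2 * (1 + 1) + 4 * (1 * 1 * 1) by ring.
rewrite (le_trans (ler_normD _ _))//; apply: lerD; rewrite normrM.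
  rewrite normrN [X in X * _]ger0_norm//.
  by rewrite ler_wpM2l// (le_trans (ler_normD _ _))// lerD// B.
rewrite [X in X * _]ger0_norm// ler_wpM2l// !normrM.
by rewrite !mulr1 !mulr_ile1 ?mulr_ge0.
Qed.

Lemma is_derive_sqnorm x v :
  is_derive x v sqnorm (\sum_i (v 0 i * x 0 i + x 0 i * v 0 i)).
Proof.
rewrite /sqnorm; under eq_fun do under eq_bigr do rewrite expr2.
by apply: is_derive_sumr => i; apply: is_derive_mul; exact: is_derive_coord.
Qed.

Lemma is_derive_sqnorm_delta x j :
  is_derive x (delta_mx 0 j : 'rV[R]_n) sqnorm (2 * x 0 j).
Proof.
apply: (is_derive_eq (is_derive_sqnorm x (delta_mx 0 j))).
rewrite (bigD1 j)//= !mxE !eqxx/= mul1r mulr1 big1.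
  by rewrite addr0 mulrDl mul1r.
by move=> i ij; rewrite mxE (negbTE ij)/= mul0r mulr0 addr0.
Qed.

Lemma is_derive_coord_delta x j a :
  is_derive x (delta_mx 0 j : 'rV[R]_n) (fun z : 'rV[R]_n => z 0 a) (j == a)%:R.
Proof.
apply: (is_derive_eq (is_derive_coord x (delta_mx 0 j) a)).
by rewrite mxE eqxx eq_sym.
Qed.

Lemma is_derive_reflection x j a b : 0 < enorm x ->
  is_derive x (delta_mx 0 j : 'rV[R]_n) (fun z => reflection z a b)
    (dreflection j x a b).
Proof.
move=> /sqnorm_gt0; rewrite lt0r => /andP[s0 _].
have H := is_derive_add
  (is_derive_cst ((a == b)%:R : R) x (delta_mx 0 j))
  (is_derive_mul (is_derive_mul (is_derive_mul
    (is_derive_cst (- 2 : R) x (delta_mx 0 j))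
    (is_derive_coord_delta x j a)) (is_derive_coord_delta x j b))
    (is_derive_inv s0 (is_derive_sqnorm_delta x j))).
have -> : (fun z => reflection z a b) =
   (fun z => (a == b)%:R + (-2 * z 0 a * z 0 b) * (sqnorm z)^-1).
  by apply/funext => z; rewrite /reflection !mulNr.
by apply: (is_derive_eq H); rewrite /dreflection /cst /=; field.
Qed.

Lemma is_derive_inversion x j l : 0 < enorm x ->
  is_derive x (delta_mx 0 j : 'rV[R]_n) (fun z => inversion z 0 l)
    ((sqnorm x)^-1 * reflection x j l).
Proof.
move=> /sqnorm_gt0; rewrite lt0r => /andP[s0 _].
have H := is_derive_mul (is_derive_coord_delta x j l)
    (is_derive_inv s0 (is_derive_sqnorm_delta x j)).
under eq_fun do rewrite inversionE.
by apply: (is_derive_eq H); rewrite /reflection /cst /=; field.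
Qed.

Lemma continuous_coord x a : {for x, continuous (fun z : 'rV[R]_n => z 0 a)}.
Proof. exact: coord_continuous. Qed.

Lemma continuous_sqnormV x : 0 < enorm x ->
  {for x, continuous (fun z => (sqnorm z)^-1)}.
Proof.
move=> /sqnorm_gt0; rewrite lt0r => /andP[s0 _].
by apply: continuous_inv => //; exact: continuous_sum_sqr.
Qed.

Lemma continuous_reflection x a b : 0 < enorm x ->
  {for x, continuous (fun z => reflection z a b)}.
Proof.
move=> x0; apply: continuous_sub; first exact: continuous_const.
apply: continuous_mul; last exact: continuous_sqnormV.
apply: continuous_mul; last exact: continuous_coord.
by apply: continuous_mul; [exact: continuous_const|exact: continuous_coord].
Qed.

Lemma continuous_dreflection j x a b : 0 < enorm x ->
  {for x, continuous (fun z => dreflection j z a b)}.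
Proof.
move=> x0; have cs := continuous_sqnormV x0.
have -> : (fun z => dreflection j z a b) = (fun z =>
    (- 2 * ((j == a)%:R * z 0 b + (j == b)%:R * z 0 a)) * (sqnorm z)^-1
    + 4 * z 0 a * z 0 b * z 0 j * ((sqnorm z)^-1 * (sqnorm z)^-1)).
  apply/funext => z; rewrite /dreflection; congr (_ + _ * _).
  by rewrite expr2 invfM.
have cc := @continuous_coord x; have ck (c : R) := @continuous_const R n c x.
apply: continuous_add.
  by apply: continuous_mul => //; apply: continuous_mul => //;
    apply: continuous_add; exact: continuous_mul.
apply: continuous_mul; last exact: continuous_mul.
by do 3 apply: continuous_mul => //.
Qed.

Lemma continuous_enorm x : {for x, continuous (@enorm R n)}.
Proof.
apply: (@continuous_comp _ _ _ sqnorm Num.sqrt); last exact: sqrt_continuous.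
exact: continuous_sum_sqr.
Qed.

Lemma continuous_inversion x : 0 < enorm x ->
  {for x, continuous (@inversion R n)}.
Proof.
move=> x0; apply: (@cvg_rV _ _ _ (nbhs_filter x)) => i.
rewrite inversionE; under eq_fun do rewrite inversionE.
by apply: continuous_mul; [exact: continuous_coord|exact: continuous_sqnormV].
Qed.

End inversion.

(** * The induced metric on the slice *)

Section jacobians.
Variable R : realType.

Lemma differentiable_rV (m p : nat) (F : 'rV[R]_m -> 'rV[R]_p) x :
  (forall k, differentiable (fun z => F z 0 k) x) -> differentiable F x.
Proof.
move=> dF.
have -> : F = \sum_(k < p) (fun z => F z 0 k *: (delta_mx 0 k : 'rV[R]_p)).
  by apply/funext => z; rewrite fct_sumE; exact: row_sum_delta.
by apply: differentiable_sum => k; exact: differentiableZl.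
Qed.

Lemma derive_coord (m p : nat) (F : 'rV[R]_m -> 'rV[R]_p) x v k :
  differentiable F x -> ('D_v F x) 0 k = 'D_v (fun z => F z 0 k) x.
Proof.
move=> dF; have /derive_mx -> := @diff_derivable _ _ _ F x v dF.
by rewrite mxE.
Qed.

Lemma jacobianE (m p : nat) (F : 'rV[R]_m -> 'rV[R]_p) x i k :
  differentiable F x -> ('J F x) i k = partial i (fun z => F z 0 k) x.
Proof. by move=> dF; rewrite /jacobian mxE -deriveE// derive_coord. Qed.

Lemma is_derive_comp_rV (m p : nat) (u : 'rV[R]_p -> R)
    (F : 'rV[R]_m -> 'rV[R]_p) x j :
  differentiable F x -> differentiable u (F x) ->
  is_derive x (delta_mx 0 j : 'rV[R]_m) (fun z => u (F z))
    (\sum_l partial j (fun z => F z 0 l) x * partial l u (F x)).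
Proof.
move=> dF du; have duF : differentiable (u \o F) x by exact: differentiable_comp.
apply: DeriveDef; first exact: diff_derivable.
rewrite [LHS]deriveE// diff_comp//= -(deriveE _ dF) ['D__ F x]row_sum_delta.
rewrite linear_sum; apply: eq_bigr => l _.
by rewrite linearZ/= derive_coord// -deriveE.
Qed.

Lemma differentiable_sqnorm (n : nat) (x : 'rV[R]_n) :
  differentiable (@sqnorm R n) x.
Proof.
have -> : @sqnorm R n = \sum_(i < n) (fun z : 'rV[R]_n => z 0 i * z 0 i).
  by apply/funext => z; rewrite fct_sumE; under [RHS]eq_bigr do rewrite -expr2.
by apply: differentiable_sum => i; apply: differentiableM;
  exact: differentiable_coord.
Qed.

Lemma differentiable_inversion (n : nat) (x : 'rV[R]_n) : 0 < enorm x ->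
  differentiable (@inversion R n) x.
Proof.
move=> x0; apply: differentiable_rV => l.
have -> : (fun z : 'rV[R]_n => inversion z 0 l) =
    (fun z : 'rV[R]_n => z 0 l) * (fun z : 'rV[R]_n => (sqnorm z)^-1).
  by apply/funext => z; rewrite inversionE.
apply: differentiableM; first exact: differentiable_coord.
apply: differentiableV; first exact: differentiable_sqnorm.
by rewrite gt_eqF// sqnorm_gt0.
Qed.

Lemma jacobian_inversion (n : nat) (x : 'rV[R]_n) i k : 0 < enorm x ->
  ('J (@inversion R n) x) i k = (sqnorm x)^-1 * reflection x i k.
Proof.
move=> x0; rewrite jacobianE; last exact: differentiable_inversion.
by have [_ E] := is_derive_inversion i k x0; exact: E.
Qed.

End jacobians.

Section time_zero.
Variables (R : realType) (n : nat).
Implicit Types (y : 'rV[R]_n) (f : 'rV[R]_(1 + n) -> R).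

Lemma time_zero_line (h : R) y i :
  time_zero (h *: delta_mx 0 i + y) =
  h *: delta_mx 0 (rshift 1 i) + time_zero y.
Proof.
apply/rowP => k; rewrite /time_zero !mxE.
case: (split_ordP k) => j ->; rewrite ?(mxE, eqxx)/=.
  by rewrite -val_eqE/= (ord1 j) mulr0 addr0.
by rewrite (inj_eq (@rshift_inj _ _)).
Qed.

(** Moving along a spatial axis never leaves the slice, so partial derivatives restrict to it
    without a chain rule. *)
Lemma growth_time_zero f y i :
  (fun h : R => h^-1 *: (((fun z => f (time_zero z)) \o shift y)
     (h *: delta_mx 0 i) - f (time_zero y))) =
  (fun h : R => h^-1 *: ((f \o shift (time_zero y))
     (h *: delta_mx 0 (rshift 1 i)) - f (time_zero y))).
Proof. by apply/funext => h /=; rewrite time_zero_line. Qed.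

Lemma derivable_time_zero f y i :
  derivable f (time_zero y) (delta_mx 0 (rshift 1 i)) ->
  derivable (fun z => f (time_zero z)) y (delta_mx 0 i).
Proof. by rewrite /derivable growth_time_zero. Qed.

Lemma partial_time_zero f i :
  partial i (fun z => f (time_zero z)) =
  (fun y => partial (rshift 1 i) f (time_zero y)).
Proof.
by apply/funext => y; rewrite /partial /derive growth_time_zero.
Qed.

Lemma time_zero_coordl y j : time_zero y 0 (lshift n j) = 0.
Proof. by rewrite /time_zero row_mxEl mxE. Qed.

Lemma time_zero_coordr y j : time_zero y 0 (rshift 1 j) = y 0 j.
Proof. by rewrite /time_zero row_mxEr. Qed.

Lemma differentiable_time_zero y : differentiable (@time_zero R n) y.
Proof.
apply: differentiable_rV => k; case: (split_ordP k) => j ->.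
  by under eq_fun do rewrite time_zero_coordl; exact: differentiable_cst.
by under eq_fun do rewrite time_zero_coordr; exact: differentiable_coord.
Qed.

Lemma jacobian_time_zero y : 'J (@time_zero R n) y = row_mx 0 1%:M.
Proof.
apply/matrixP => i k; rewrite jacobianE; last exact: differentiable_time_zero.
case: (split_ordP k) => j ->.
  rewrite row_mxEl mxE /partial; under eq_fun do rewrite time_zero_coordl.
  exact: derive_cst.
rewrite row_mxEr mxE /partial; under eq_fun do rewrite time_zero_coordr.
by have [_ ->] := is_derive_coord_delta y i j.
Qed.

Lemma Ck_time_zero k (U : set 'rV[R]_(1 + n)) (f : 'rV[R]_(1 + n) -> R) :
  Ck k U f -> Ck k (@time_zero R n @^-1` U) (fun y => f (time_zero y)).
Proof.
have cont (g : 'rV[R]_(1 + n) -> R) y : {for time_zero y, continuous g} ->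
    {for y, continuous (fun y => g (time_zero y))}.
  move=> cg; apply: (@continuous_comp _ _ _ (@time_zero R n) g) => //.
  exact/differentiable_continuous/differentiable_time_zero.
elim: k f => [|k IH] f [cf H]; split => //; try by move=> y /cf; exact: cont.
move=> i; have [df Cf] := H (rshift 1 i); split.
  by move=> y /df; exact: derivable_time_zero.
by rewrite partial_time_zero; exact: IH.
Qed.

Lemma pullback_time_zero (G : 'rV[R]_(1 + n) -> 'M[R]_(1 + n)) y a b :
  pullback (@time_zero R n) G y a b = G (time_zero y) (rshift 1 a) (rshift 1 b).
Proof.
rewrite /pullback jacobian_time_zero.
suff -> : row_mx 0 1%:M *m G (time_zero y) *m (row_mx 0 1%:M)^T =
    drsubmx (G (time_zero y)) by rewrite !mxE.
rewrite -[in LHS](submxK (G _)) tr_row_mx mul_row_block mul_row_col trmx0 trmx1.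
by rewrite !mul0mx mulmx0 !add0r mul1mx mulmx1.
Qed.

Lemma tau_time_zero y : tau (time_zero y) = 0.
Proof.
rewrite /tau -[RHS](time_zero_coordl y 0); congr (time_zero y 0 _).
exact: val_inj.
Qed.

Lemma rho_time_zero y : rho (time_zero y) = enorm y.
Proof. by rewrite /rho /time_zero row_mxKr. Qed.

(** At [tau = 0] the conformal factor is [rho ^- 4], that is [|x|^4], and the two Jacobians of the
    inversion contribute [|x|^-2] each; these cancel and two reflections remain. The bound on
    [enorm x] is [rho < delta] read through the inversion. *)
Lemma slice_metricE (delta : R) (g h : 'rV[R]_(1 + n) -> 'M[R]_(1 + n))
    (x : 'rV[R]_n) a b : conformal_completion delta g h ->
  delta^-1 < enorm x ->
  slice_metric g x a b = (a == b)%:R + \sum_c \sum_d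
    reflection x a c * h (time_zero (inversion x)) (rshift 1 c) (rshift 1 d) *
    reflection x b d.
Proof.
move=> [d0 _ Hg _ _] xd.
have x0 : 0 < enorm x by rewrite (lt_trans _ xd)// invr_gt0.
have s0 : sqnorm x != 0 by rewrite gt_eqF// sqnorm_gt0.
set y := inversion x.
have yE : enorm y = (enorm x)^-1 by exact: enorm_inversion.
have gE c d : g (time_zero y) (rshift 1 c) (rshift 1 d) = sqnorm x ^+ 2 *
    ((c == d)%:R + h (time_zero y) (rshift 1 c) (rshift 1 d)).
  rewrite Hg; last first.
    rewrite tau_time_zero rho_time_zero normr0 yE invr_gt0 x0/=.
    by rewrite invf_plt.
  rewrite tau_time_zero rho_time_zero yE expr0n subr0 exprVn enorm_sqr.
  rewrite mxE -exprVn invrK; congr (_ * _); rewrite mxE; congr (_ + _).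
  by rewrite /eta block_mxEdr mxE.
rewrite /slice_metric {1}/pullback mxE.
under eq_bigr do rewrite mxE big_distrl/=.
rewrite exchange_big/=.
have E c d : 'J (@inversion R n) x a c * pullback (@time_zero R n) g y c d *
    (('J (@inversion R n) x)^T) d b =
    (c == d)%:R * (reflection x a c * reflection x b d) +
    reflection x a c * h (time_zero y) (rshift 1 c) (rshift 1 d) *
      reflection x b d.
  rewrite pullback_time_zero gE [X in _ * X]mxE !jacobian_inversion//.
  by field.
under eq_bigr do under eq_bigr do rewrite E.
rewrite -(reflection_involutive a b x0) -big_split/=; apply: eq_bigr => c _.
rewrite big_split/=; congr (_ + _).
rewrite (bigD1 c)//= eqxx mul1r big1 ?addr0// => d dc.
by rewrite eq_sym (negbTE dc) mul0r.
Qed.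

End time_zero.

(** * The flux at infinity *)

Lemma unit_sphere_integral_ext (R : realType) (m : nat) (f g : 'rV[R]_m -> R) :
  (forall x, unit_sphere x -> f x = g x) ->
  unit_sphere_integral f = unit_sphere_integral g.
Proof.
elim: m f g => [//|[|k] IH] f g fg.
  by rewrite /= !fg// /unit_sphere/= big_ord1 mxE ?sqrrN expr1n.
rewrite !unit_sphere_integralS; apply: eq_Rintegral => t _; congr (_ * _).
by apply: IH => w Sw; exact/fg/polar_unit_sphere.
Qed.

Lemma norm_sum_le (R : realType) (m : nat) (F : 'I_m -> R) (B : R) :
  (forall i, `|F i| <= B) -> `|\sum_(i < m) F i| <= m%:R * B.
Proof.
move=> FB; apply: (le_trans (ler_norm_sum _ _ _)).
apply: (@le_trans _ _ (\sum_(i < m) B)); first exact: ler_sum.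
by rewrite sumr_const card_ord mulr_natl.
Qed.

Section asymptotics.
Variables (R : realType) (k : nat).
(** The decay order [n - 2] becomes [k.+1], the exponent [n - 1] of the sphere area becomes [k.+2],
    and odd [n] means even [k]. *)
Let n := k.+3.
Variables (u : 'I_n -> 'I_n -> 'rV[R]_n -> R) (d r0 : R).
Variable gamma : 'rV[R]_n -> 'M[R]_n.
Hypotheses (d0 : 0 < d) (r00 : 0 < r0) (k_even : ~~ odd k).
Hypothesis u_class : forall c e, Ck k.+1 [set y : 'rV[R]_n | `|y| < d] (u c e).
Hypothesis u_decay : forall c e, bigO0 (u c e) k.+1.
Hypothesis gammaE : forall x a b, r0 < enorm x ->
  gamma x a b = (a == b)%:R + \sum_c \sum_e
    reflection x a c * u c e (inversion x) * reflection x b e.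

Let inverted_gradient (j : 'I_n) (x : 'rV[R]_n) (c e : 'I_n) : R :=
  \sum_l (sqnorm x)^-1 * reflection x j l * partial l (u c e) (inversion x).

(** The product rule for the derivative along [j] of the component [(a, b)] of [gamma], written out
    so that parity and size can be read off each term. *)
Let dgamma (j a b : 'I_n) (x : 'rV[R]_n) : R := \sum_c \sum_e
  ((dreflection j x a c * u c e (inversion x) +
    reflection x a c * inverted_gradient j x c e) * reflection x b e +
   reflection x a c * u c e (inversion x) * dreflection j x b e).

(** Beyond [r0] the expansion of [gamma] holds; beyond [d^-1] the inverted point lies in the ball
    where [u] is regular. *)
Let far (x : 'rV[R]_n) := r0 < enorm x /\ d^-1 < enorm x.

Let far_gt0 x : far x -> 0 < enorm x.
Proof. by move=> [+ _]; exact: lt_trans. Qed.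

Let far_inversion x : far x -> `|inversion x| < d.
Proof.
move=> fx; have x0 := far_gt0 fx; apply: le_lt_trans (norm_le_enorm _) _.
by rewrite enorm_inversion// invf_plt// fx.2.
Qed.

Let open_ball0 : open [set y : 'rV[R]_n | `|y| < d].
Proof.
have -> : [set y : 'rV[R]_n | `|y| < d] = ball (0 : 'rV[R]_n) d.
  by rewrite -ball_normE; apply/seteqP; split=> y /=; rewrite sub0r normrN.
exact: ball_open.
Qed.

Let is_derive_u_inversion x j c e : far x ->
  is_derive x (delta_mx 0 j : 'rV[R]_n) (fun z => u c e (inversion z))
    (inverted_gradient j x c e).
Proof.
move=> fx; have x0 := far_gt0 fx.
apply: (is_derive_eq (is_derive_comp_rV _ (differentiable_inversion x0)
  (Ck_differentiable open_ball0 (u_class c e) (far_inversion fx)))).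
apply: eq_bigr => l _; congr (_ * _).
by have [_ E] := is_derive_inversion j l x0; exact: E.
Qed.

Let is_derive_gamma x j a b : far x ->
  is_derive x (delta_mx 0 j : 'rV[R]_n) (fun z => gamma z a b) (dgamma j a b x).
Proof.
move=> fx; have x0 := far_gt0 fx.
(* [gamma] agrees with the expansion only outside a ball, hence near [x], which is enough for a
   derivative. *)
apply: (@near_eq_is_derive _ _ _ (fun z => (a == b)%:R + \sum_c \sum_e
    reflection z a c * u c e (inversion z) * reflection z b e)).
  have : \forall z \near x, r0 < enorm z.
    by apply: (@cvgr_gt _ _ _ _ _ _ (@continuous_enorm R n x)); exact: fx.1.
  by apply: filterS => z /gammaE ->.
rewrite -[dgamma _ _ _ _]add0r; apply: is_derive_add.
apply: is_derive_sumr => c; apply: is_derive_sumr => e.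
apply: is_derive_mul; last exact: is_derive_reflection.
apply: is_derive_mul; first exact: is_derive_reflection.
exact: is_derive_u_inversion.
Qed.

Let continuous_dgamma x j a b : far x -> {for x, continuous (dgamma j a b)}.
Proof.
move=> fx; have x0 := far_gt0 fx; have xd := far_inversion fx.
have cu c e : {for x, continuous (fun z => u c e (inversion z))}.
  apply: (@continuous_comp _ _ _ (@inversion R n)).
    exact: continuous_inversion.
  exact: Ck_continuous (u_class c e) xd.
have cdu c e l : {for x, continuous (fun z => partial l (u c e) (inversion z))}.
  apply: (@continuous_comp _ _ _ (@inversion R n)).
    exact: continuous_inversion.
  exact: Ck_continuous (Ck_partial l (u_class c e)) xd.
have cr a' b' := @continuous_reflection R n x a' b' x0.
have cdr a' b' := @continuous_dreflection R n j x a' b' x0.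
have cs := continuous_sqnormV x0.
apply: continuous_sum => c; apply: continuous_sum => e.
apply: continuous_add; last by do 2 apply: continuous_mul => //.
apply: continuous_mul => //; apply: continuous_add; apply: continuous_mul => //.
by apply: continuous_sum => l; do 2 apply: continuous_mul => //.
Qed.

(** [reflection] is even and [dreflection] odd, so the difference involves [u] and its gradient only
    through antipodal combinations. Each of the two terms with a [dreflection] gives [8 * 3], hence
    [48]; the gradient term gives [3 * 3 * 3 * n]. *)
Let dgamma_antipodal e : 0 < e -> exists2 r : R, 0 < r & forall x j a b,
  r < enorm x -> `|dgamma j a b x - dgamma j a b (- x)| <=
    n%:R * (n%:R * ((48 + 27 * n%:R) * (e * (enorm x)^-1 ^+ k.+2))).
Proof.
move=> e0.
have uo (p : 'I_n * 'I_n) : littleo0 (antipodal k.+1 (u p.1 p.2)) k.+1.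
  exact: littleo0_antipodal d0 (u_class _ _) (u_decay _ _).
have duo (p : 'I_n * ('I_n * 'I_n)) :
    littleo0 (antipodal k (partial p.1 (u p.2.1 p.2.2))) k.
  apply: (littleo0_antipodal d0); first exact: Ck_partial.
  exact: bigO0_partial d0 (u_class _ _) (u_decay _ _).
have [d1 d10 H1] := littleo0_uniform uo e0.
have [d2 d20 H2] := littleo0_uniform duo e0.
exists (Num.max d1^-1 d2^-1); first by rewrite lt_max invr_gt0 d10.
move=> x j a b; rewrite gt_max => /andP[xd1 xd2].
have x0 : 0 < enorm x by rewrite (lt_trans _ xd1)// invr_gt0.
pose L := (enorm x)^-1; rewrite -/L.
have L0 : 0 < L by rewrite invr_gt0.
have Ld1 : 0 < L < d1 by rewrite L0 invf_plt.
have Ld2 : 0 < L < d2 by rewrite L0 invf_plt.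
have sL : (sqnorm x)^-1 = L ^+ 2 by rewrite -enorm_sqr exprVn.
set y := inversion x.
have yL : `|y| <= L by rewrite (le_trans (norm_le_enorm _))// enorm_inversion.
rewrite /dgamma -sumrB; apply: norm_sum_le => c.
rewrite -sumrB; apply: norm_sum_le => f.
pose K := antipodal k.+1 (u c f) y.
pose W := \sum_l L ^+ 2 * reflection x j l * antipodal k (partial l (u c f)) y.
(* As [k] is even, [antipodal] is a sum in degree [k.+1] and a difference in degree [k]. *)
have KE : K = u c f y + u c f (- y).
  by rewrite /K /antipodal -signr_odd/= k_even expr1 mulN1r opprK.
have WE : W = inverted_gradient j x c f - inverted_gradient j (- x) c f.
  rewrite /inverted_gradient -sumrB; apply: eq_bigr => l _.
  rewrite reflectionN sqnormN inversionN sL -mulrBr /antipodal -signr_odd.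
  by rewrite (negbTE k_even) expr0 mul1r.
rewrite !reflectionN !dreflectionN inversionN -/y.
set A := reflection x a c; set B := reflection x b f.
set D := dreflection j x a c; set D' := dreflection j x b f.
have -> : (D * u c f y + A * inverted_gradient j x c f) * B + A * u c f y * D' -
   ((- D * u c f (- y) + A * inverted_gradient j (- x) c f) * B +
     A * u c f (- y) * - D') = (D * K + A * W) * B + A * K * D'.
  by rewrite KE WE; ring.
have hK : `|K| <= e * L ^+ k.+1 by exact: (H1 (c, f)).
have hW : `|W| <= n%:R * (L ^+ 2 * 3 * (e * L ^+ k)).
  apply: norm_sum_le => l; rewrite normrM ler_pM//.
    by rewrite normrM; apply: ler_pM; rewrite ?reflection_le// normrX gtr0_norm.
  exact: (H2 (l, (c, f))).
have hA : `|A| <= 3 by exact: reflection_le.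
have hB : `|B| <= 3 by exact: reflection_le.
have hD : `|D| <= 8 * L by exact: dreflection_le.
have hD' : `|D'| <= 8 * L by exact: dreflection_le.
have -> : (48 + 27 * n%:R) * (e * L ^+ k.+2) =
  (8 * L * (e * L ^+ k.+1) + 3 * (n%:R * (L ^+ 2 * 3 * (e * L ^+ k)))) * 3
  + 3 * (e * L ^+ k.+1) * (8 * L) by rewrite !exprS; ring.
rewrite (le_trans (ler_normD _ _))//; apply: lerD; rewrite !normrM.
  apply: ler_pM => //; rewrite (le_trans (ler_normD _ _))//.
  by apply: lerD; rewrite normrM; apply: ler_pM.
by apply: ler_pM => //; exact: ler_pM.
Qed.

Let flux_density (x : 'rV[R]_n) : R := \sum_i \sum_j
  (dgamma j i j x - dgamma i j j x) * (x 0 i / enorm x).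

Let continuous_flux_density x : far x -> {for x, continuous flux_density}.
Proof.
move=> fx; apply: continuous_sum => i; apply: continuous_sum => j.
apply: continuous_mul; first by apply: continuous_sub; exact: continuous_dgamma.
apply: continuous_mul; first exact: continuous_coord.
apply: continuous_inv; first by rewrite gt_eqF// far_gt0.
exact: continuous_enorm.
Qed.

(** The normal [x / |x|] is odd, so adding the densities at antipodes subtracts the values of
    [dgamma]; the factor 2 counts the two [dgamma] terms of the density. *)
Let flux_density_antipodal e : 0 < e -> exists2 r : R, 0 < r & forall x,
  r < enorm x -> `|flux_density x + flux_density (- x)| <=
    n%:R * (n%:R * (2 * (n%:R * (n%:R *
      ((48 + 27 * n%:R) * (e * (enorm x)^-1 ^+ k.+2)))))).
Proof.
move=> e0; have [r r_gt0 Hr] := dgamma_antipodal e0; exists r => // x rx.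
have x0 : 0 < enorm x by exact: lt_trans rx.
rewrite /flux_density -big_split; apply: norm_sum_le => i /=.
rewrite -big_split; apply: norm_sum_le => j /=.
rewrite enormN mxE.
have -> : (dgamma j i j x - dgamma i j j x) * (x 0 i / enorm x) +
    (dgamma j i j (- x) - dgamma i j j (- x)) * (- x 0 i / enorm x) =
  ((dgamma j i j x - dgamma j i j (- x)) - (dgamma i j j x - dgamma i j j (- x)))
    * (x 0 i / enorm x) by ring.
rewrite normrM -[leRHS]mulr1 ler_pM//; last exact: ler_norm_div.
by rewrite mulr_natl mulr2n (le_trans (ler_normB _ _))// lerD// Hr.
Qed.

Lemma adm_mass_vanishes_expansion : adm_mass_vanishes gamma.
Proof.
have [C C0 [bnd lin neg]] := sphere_functional R n.
pose M := C * (n%:R * (n%:R * (2 * (n%:R * (n%:R * (48 + 27 * n%:R)))))) : R.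
have M0 : 0 <= M by rewrite !mulr_ge0.
apply/cvgrPdist_le => e e0.
have e1 : 0 < e / (M + 1) by rewrite divr_gt0// ltr_wpDl.
have [r1 r10 Hr1] := flux_density_antipodal e1.
near=> r.
have r_gt0 : 0 < r by near: r; apply: nbhs_pinfty_gt; exact: num_real.
have r0r : r0 < r by near: r; apply: nbhs_pinfty_gt; exact: num_real.
have dr : d^-1 < r by near: r; apply: nbhs_pinfty_gt; exact: num_real.
have enormr w : unit_sphere w -> enorm (r *: w : 'rV[R]_n) = r.
  by move=> Sw; rewrite enormZ /enorm Sw sqrtr1 mulr1 gtr0_norm.
have farr w : unit_sphere w -> far (r *: w : 'rV[R]_n).
  by move=> Sw; rewrite /far enormr.
have rr1 : r1 < r by near: r; apply: nbhs_pinfty_gt; exact: num_real.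
pose F (w : 'rV[R]_n) := flux_density (r *: w).
have cF : continuous_on_sphere F.
  move=> w Sw; apply: (@continuous_comp _ _ _ (fun w : 'rV[R]_n => r *: w)).
    exact: scaler_continuous.
  exact/continuous_flux_density/farr.
have SN (w : 'rV[R]_n) : unit_sphere w -> unit_sphere (- w).
  by rewrite /unit_sphere /= => <-; apply: eq_bigr => i _; rewrite mxE sqrrN.
have cFN : continuous_on_sphere (fun w => F (- w)).
  move=> w Sw; apply: (@continuous_comp _ _ _ (fun w : 'rV[R]_n => - w)).
    exact: opp_continuous.
  exact/cF/SN.
have -> : adm_flux gamma r = r ^+ k.+2 * unit_sphere_integral F.
  apply: (congr1 (fun I => r ^+ k.+2 * I)).
  apply: unit_sphere_integral_ext => w Sw.
  apply: eq_bigr => i _; apply: eq_bigr => j _; congr ((_ - _) * _).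
    by have [_ E] := is_derive_gamma j i j (farr w Sw); exact: E.
  by have [_ E] := is_derive_gamma i j j (farr w Sw); exact: E.
(* Antipodal invariance turns twice the integral into the integral of [F w + F (- w)], where the
   cancellation takes place pointwise. *)
have I2 : unit_sphere_integral F *+ 2 =
    unit_sphere_integral (fun w => 1 * F w + F (- w)).
  by rewrite (lin 1 F (fun w => F (- w)) cF cFN) (neg F cF) mul1r -mulr2n.
have {}bnd : `|unit_sphere_integral F *+ 2| <=
    M * (e / (M + 1) * r^-1 ^+ k.+2).
  have FN w : unit_sphere w -> `|1 * F w + F (- w)| <=
      n%:R * (n%:R * (2 * (n%:R * (n%:R *
      ((48 + 27 * n%:R) * (e / (M + 1) * r^-1 ^+ k.+2)))))).
    move=> Sw; rewrite mul1r /F scalerN.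
    by have := Hr1 (r *: w); rewrite enormr//; apply.
  have cI : continuous_on_sphere (fun w => 1 * F w + F (- w)).
    move=> w Sw; apply: continuous_add; last exact: cFN.
    by apply: continuous_mul; [exact: continuous_const|exact: cF].
  rewrite I2; apply: le_trans (bnd _ _ cI FN) _.
  rewrite le_eqVlt; apply/orP; left; apply/eqP; rewrite /M.
  by move: (e / _ * _) => t; rewrite -!mulrA.
rewrite sub0r normrN normrM ger0_norm ?exprn_ge0 ?(ltW r_gt0)//.
have half : `|unit_sphere_integral F| <= `|unit_sphere_integral F *+ 2|.
  by rewrite normrMn mulr2n lerDl.
apply: le_trans (ler_wpM2l (exprn_ge0 _ (ltW r_gt0)) (le_trans half bnd)) _.
(* The area factor cancels the decay exactly, leaving the small factor [e / (M + 1)] supplied by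
   parity. *)
have -> : r ^+ k.+2 * (M * (e / (M + 1) * r^-1 ^+ k.+2)) = M * (e / (M + 1)).
  rewrite exprVn; field.
  by rewrite expf_neq0 ?gt_eqF//= ltr_wpDl.
rewrite mulrCA ger_pMr// ler_pdivrMr ?ltr_wpDl// mul1r lerDl.
exact: ler01.
Unshelve. all: by end_near. Qed.

End asymptotics.

(** * From the conformal completion to the asymptotic expansion *)

Lemma norm_time_zero_le (R : realType) (n : nat) (y : 'rV[R]_n) :
  `|time_zero y| <= `|y|.
Proof.
apply: norm_rV_le => // i; case: (split_ordP i) => j ->.
  by rewrite time_zero_coordl normr0.
by rewrite time_zero_coordr coord_le_norm.
Qed.

(** The slice [tau = 0] lies in the cone [|tau| <= rho]. As [rho] is Euclidean while [bigO0] uses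
    the sup norm, the constant picks up [n ^ m]. *)
Lemma bigO0_time_zero (R : realType) (n m : nat) (f : 'rV[R]_(1 + n) -> R) :
  (let F := within [set y | `|tau y| <= rho y] (nbhs (0 : 'rV[R]_(1 + n))) in
   f =O_F (fun y => rho y ^+ m)) ->
  bigO0 (fun y => f (time_zero y)) m.
Proof.
move=> /= /eqOP H.
have [C [C0 HC]] : exists C : R, 0 <= C /\ \forall y \near
    within [set y | `|tau y| <= rho y] (nbhs (0 : 'rV[R]_(1 + n))),
    `|f y| <= C * `|rho y ^+ m|.
  have : \forall C \near (+oo : set_system R), 0 <= C /\ \forall y \near
    within [set y | `|tau y| <= rho y] (nbhs (0 : 'rV[R]_(1 + n))),
    `|f y| <= C * `|rho y ^+ m|.
    by near=> C; split; near: C => //; apply: nbhs_pinfty_ge; exact: num_real.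
  by move=> /filter_ex[C HC]; exists C.
move: HC; rewrite near_withinE => /nbhs_ballP[d /= d0 Hd].
exists (C * n%:R ^+ m), d; split => //; first by rewrite mulr_ge0// exprn_ge0.
move=> y L yL /andP[L0 Ld].
have := Hd (time_zero y); rewrite -ball_normE/= sub0r normrN.
rewrite tau_time_zero rho_time_zero normr0 enorm_ge0.
move=> /(_ (le_lt_trans (norm_time_zero_le y) (le_lt_trans yL Ld)) isT).
move=> /le_trans; apply; rewrite -mulrA ler_wpM2l// -exprMn normrX.
rewrite ger0_norm ?enorm_ge0// lerXn2r ?nnegrE ?enorm_ge0//.
  by rewrite mulr_ge0// ltW.
by apply: (le_trans (enorm_le_norm _)); rewrite ler_wpM2l.
Unshelve. all: by end_near. Qed.

(** Agreement of [gamma] with the slice metric only beyond [r0] lets one statement serve both for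
    the slice metric itself and for a given metric that has a completion. *)
Lemma adm_mass_vanishes_completion (R : realType) (n : nat) (delta : R)
    (g h : 'rV[R]_(1 + n) -> 'M[R]_(1 + n)) (gamma : 'rV[R]_n -> 'M[R]_n)
    (r0 : R) : (3 <= n)%N -> odd n -> conformal_completion delta g h ->
  (forall x, r0 < enorm x -> gamma x = slice_metric g x) ->
  adm_mass_vanishes gamma.
Proof.
case: n g h gamma => [//|[//|[//|k]]] g h gamma _ k_odd Hc gammaE.
have [d0 _ _ [U [oU U0] Cu] decay] := Hc.
have /nbhs_ballP[d /= d_gt0 Ud] : nbhs (0 : 'rV[R]_(1 + k.+3)) U.
  exact: open_nbhs_nbhs.
pose u (c e : 'I_k.+3) (y : 'rV[R]_k.+3) :=
  h (time_zero y) (rshift 1 c) (rshift 1 e).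
(* Beyond [delta^-1] the inverted point satisfies [rho < delta]; this term also keeps the radius
   positive whatever the sign of [r0]. *)
apply: (@adm_mass_vanishes_expansion R k u d (Num.max r0 delta^-1) gamma) => //.
- by rewrite lt_max invr_gt0 d0 orbT.
- by move: k_odd; rewrite /= negbK.
- move=> c e; apply: (@Ck_sub _ _ (@time_zero R k.+3 @^-1` U)).
    move=> y /= yd; apply: Ud; rewrite -ball_normE/= sub0r normrN.
    exact: le_lt_trans (norm_time_zero_le y) yd.
  exact: (Ck_time_zero (Cu (rshift 1 c) (rshift 1 e))).
- move=> c e.
  by apply: (@bigO0_time_zero R k.+3 k.+1 (fun y => h y (rshift 1 c) (rshift 1 e)));
    exact: decay.
- move=> x a b; rewrite gt_max => /andP[xr0 xd].
  by rewrite gammaE// (slice_metricE _ _ Hc).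
Qed.

Unset Implicit Arguments.
Set Strict Implicit.

Theorem mainTheorem2 (R : realType) (n : nat) (n_ge3 : (3 <= n)%N)
    (n_odd : odd n) :
  (forall (delta : R) (g h : 'rV[R]_(1 + n) -> 'M[R]_(1 + n)),
     conformal_completion delta g h -> adm_mass_vanishes (slice_metric g)) /\
  (forall gamma : 'rV[R]_n -> 'M[R]_n,
     ~ adm_mass_vanishes gamma ->
     ~ exists (delta : R) (g h : 'rV[R]_(1 + n) -> 'M[R]_(1 + n)),
         conformal_completion delta g h /\
         exists r0 : R, forall x : 'rV[R]_n,
           r0 < enorm x -> gamma x = slice_metric g x).
Proof.
split=> [delta g h Hc|gamma gamma0 [delta [g [h [Hc [r0 gammaE]]]]]].
  exact: (@adm_mass_vanishes_completion R n delta g h _ 0 n_ge3 n_odd Hc).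
exact/gamma0/(adm_mass_vanishes_completion n_ge3 n_odd Hc gammaE).
Qed.
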